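(* For any $k$ and any segment sequence $\ell=(l_1,l_2,\ldots,l_m)$, among the trees in the set $\mathcal{T}_{\ell}$ of all trees with segment sequence $\ell$, the Steiner $k$-Wiener index is maximized by a quasi-caterpillar; that is, there is a quasi-caterpillar $T^*\in\mathcal{T}_\ell$ such that $SW_k(T)\le SW_k(T^* )$ for every $T\in\mathcal{T}_\ell$.
   Context: All graphs are finite and simple. For a connected graph $G$ and $S\subseteq V(G)$, the Steiner distance $d(S)$ is the minimum size (number of edges) of a connected subgraph of $G$ whose vertex set contains $S$. The Steiner $k$-Wiener index is $SW_k(G)=\sum_{S\subseteq V(G),\,|S|=k} d(S)$, where $k$ is a positive integer. A branch vertex of a tree is a vertex of degree at least 3. A segment of a tree $T$ is a subpath $P$ of $T$ such that all internal vertices of $P$ have degree 2 in $T$ and each end of $P$ is either a leaf or a branch vertex of $T$. The length of a segment is its number of edges. The segment sequence of $T$ is the sequence $(l_1,l_2,\ldots,l_m)$ of the lengths of all segments of $T$, in non-increasing order. All trees with segment sequence $\ell$ have the same order $n=1+\sum_i l_i$. A pendant segment is a segment with one end being a leaf. A quasi-caterpillar is a tree for which the removal of its pendant segments (keeping the branch vertices at which they are attached) results in a path (possibly a trivial one); equivalently, all its branch vertices lie on a common path. A path itself counts as a quasi-caterpillar. *)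

(* Defs.v *)
From mathcomp Require Import all_boot.
Set Implicit Arguments.
Unset Strict Implicit.
Unset Printing Implicit Defensive.

Record sgraph := SGraph {
  vertex :> finType;
  adj : rel vertex;
  adj_sym : symmetric adj;
  adj_irr : irreflexive adj
}.

Section Graphs.
Variable G : sgraph.
Implicit Types (x y : G) (p : seq G) (S : {set G}).

Definition edges : {set {set G}} := [set [set e.1; e.2] | e : G * G & adj e.1 e.2].

Definition deg x : nat := #|[set y | adj x y]|.
Definition leaf x : bool := deg x == 1.
Definition branch x : bool := 3 <= deg x.

(* Pairs (W, F) of a vertex set and an edge set; only those satisfying
   [is_subgraph] are subgraphs of G. *)
Definition subgraph : Type := ({set G} * {set {set G}})%type.
Implicit Type H : subgraph.

Definition is_subgraph H : bool :=
  (H.2 \subset edges) && [forall A in H.2, A \subset H.1].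

Definition is_connected H : bool :=
  (H.1 != set0) &&
  [forall x in H.1, forall y in H.1,
     connect (fun u v => [set u; v] \in H.2) x y].

Definition whole : subgraph := ([set: G], edges).

(* [ucycle] also accepts the degenerate closed walks of size at most 2. *)
Definition acyclic : Prop :=
  forall c : seq G, ucycle (@adj G) c -> size c <= 2.

Definition is_tree : Prop := is_connected whole /\ acyclic.

(* The default value of the minimum is attained by [whole], an admissible
   subgraph whenever G is connected. *)
Definition steiner_dist S : nat :=
  \big[minn/#|edges|]_(H : subgraph |
     [&& is_subgraph H, is_connected H & S \subset H.1]) #|H.2|.

Definition SW (k : nat) : nat :=
  \sum_(S : {set G} | #|S| == k) steiner_dist S.

Definition path_subgraph p : subgraph :=
  ([set x in p], [set:: [seq [set e.1; e.2] | e <- zip p (behead p)]]).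

(* A single vertex is a (trivial) path; the null graph is not a path. *)
Definition is_path H : Prop :=
  exists p, [/\ p != [::], uniq p, sorted (@adj G) p & H = path_subgraph p].

(* x and y are the ends, s lists the internal vertices; x <> y, so that
   segments have positive length. *)
Definition segment_path x (s : seq G) y : bool :=
  [&& uniq (x :: rcons s y), path (@adj G) x (rcons s y),
      all (fun z => deg z == 2) s, leaf x || branch x & leaf y || branch y].

(* Segments are subgraphs rather than vertex sequences, so that the two
   orientations of a segment are identified. *)
Definition segments : {set subgraph} :=
  [set H | [exists x : G, exists y : G, exists n : 'I_#|G|,
     exists s : n.-tuple G,
       segment_path x s y && (H == path_subgraph (x :: rcons s y))]].

Definition segment_sequence : seq nat :=
  sort geq [seq #|H.2| | H <- enum segments].

(* A leaf on a segment is one of its ends, as internal vertices have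
   degree 2. *)
Definition pendant_segments : {set subgraph} :=
  [set H in segments | [exists x in H.1, leaf x]].

Definition remove_pendant : subgraph :=
  ([set x | branch x || [forall H in pendant_segments, x \notin H.1]],
   edges :\: \bigcup_(H in pendant_segments) H.2).

(* The first disjunct is needed: a nontrivial path is its own pendant segment,
   and nothing remains when it is removed. *)
Definition quasi_caterpillar : Prop :=
  is_tree /\ (is_path whole \/ is_path remove_pendant).

Definition tree_with_segments (l : seq nat) : Prop :=
  is_tree /\ segment_sequence = l.

End Graphs.

(* Main.v *)
Require Import Defs.
From mathcomp Require Import all_boot order perm zify.
From Stdlib Require Import Classical.

Set Implicit Arguments.
Unset Strict Implicit.
Unset Printing Implicit Defensive.

(** In a tree every edge [e] is a bridge, so it has a cut: a vertex set [D]
    whose only crossing edge is [e], unique up to complement. A minimal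
    connected subgraph containing [S] consists of the edges whose cut splits
    [S] ([steiner_distE]), hence [SW] is the sum over the edges of the number
    of [k]-sets split by the cut ([SW_cuts]). This number depends only on the
    size of [D]; by convexity of binomial coefficients it does not decrease
    when the cut becomes more balanced ([nsplits_le]), and for [k = 2] it
    strictly increases ([nsplits_lt]).

    Suppose the branch vertices of a tree do not lie on one path. Then some
    vertex [y] has three neighbours [x1], [x2], [x3] such that the components
    [X1], [X2], [X3] of the tree minus [y] that contain them all contain branch
    vertices; say #|X1| <= #|X2| <= #|X3|. Let [w] be a branch vertex in [X1],
    and [Y] a component of the tree minus [w] that does not contain [y],
    attached to [w] at [v]. Exchange the subtrees [X2] and [Y]: replace the
    edges [x2 y] and [w v] by [x2 w] and [y v]. All degrees are preserved, and
    since [y] and [w] are branch vertices, where segments end, so are the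
    lengths of all segments. The only cuts that change are those separating [y]
    from [w]. The side containing [w] of such a cut has size b <= #|X1| before
    the exchange and b + #|X2| - #|Y| after it; as #|Y| < #|X1| <= #|X2| and
    2 b + #|X2| <= #|X1| + #|X2| + #|X3| < n, the new cut is more balanced.
    Thus [SW] at [k] does not decrease while [SW] at 2 strictly increases
    ([tripod_improves]).

    The sizes of all trees with a given segment sequence are bounded, so some
    tree maximizes the pair of [SW] at [k] and [SW] at 2 lexicographically. No
    such vertex [y] exists in it, so the Steiner tree of its branch vertices has
    maximum degree at most 2 and is a path ([connected_max_degree2_path]); and
    this Steiner tree is what remains after removing the pendant segments
    ([remove_pendantE]). A tree without branch vertices is itself a path. *)

(** * Edges and their cuts *)

Lemma eq_set2 (V : finType) (x y u v : V) :
  ([set x; y] == [set u; v]) = (x == u) && (y == v) || (x == v) && (y == u).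
Proof.
apply/eqP/orP => [eq2 | [] /andP[/eqP-> /eqP->] //]; last by rewrite setUC.
have := set21 x y; have := set22 x y; rewrite eq2 !inE.
have := set21 u v; have := set22 u v; rewrite -eq2 !inE !(eq_sym u) !(eq_sym v).
by do 4![case: (_ == _)]; rewrite /= ?orbT; auto.
Qed.

Section Cuts.
Variable G : sgraph.
Implicit Types (x y u v : G) (e D S : {set G}) (p q : seq G).

Lemma edgesP e :
  reflect (exists u v, adj u v /\ e = [set u; v]) (e \in edges G).
Proof.
apply: (iffP imsetP) => [[[u v] /= + ->]|[u [v [uv ->]]]].
  by rewrite inE => uv; exists u, v.
by exists (u, v); rewrite ?inE.
Qed.

Lemma edgeE u v : ([set u; v] \in edges G) = adj u v.
Proof.
apply/edgesP/idP => [[a [b [ab /eqP]]]|uv]; last by exists u, v.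
by rewrite eq_set2 => /orP[]/andP[/eqP-> /eqP->] //; rewrite adj_sym.
Qed.

Lemma adj_neq u v : adj u v -> u != v.
Proof. by apply: contraTneq => ->; rewrite adj_irr. Qed.

Definition connected_graph := forall x y, connect (@adj G) x y.

Lemma connected_whole : is_connected (whole G) -> connected_graph.
Proof.
move=> /andP[_ /forall_inP H] x y.
have /forall_inP/(_ y) := H x (in_setT x).
by rewrite inE => /(_ isT); rewrite (eq_connect edgeE).
Qed.

(** The cut condition is an equality of booleans, crossing against being [e],
    so that cuts can be combined by exclusive or. *)
Definition is_cut D e : bool :=
  [forall u, forall v, adj u v ==>
     ((u \in D) (+) (v \in D) == ([set u; v] == e))].

Lemma is_cutP D e :
  reflect (forall u v, adj u v -> (u \in D) (+) (v \in D) = ([set u; v] == e))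
          (is_cut D e).
Proof.
apply: (iffP forallP) => [H u v uv | H u].
  by have /forallP/(_ v)/implyP/(_ uv)/eqP := H u.
by apply/forallP => v; apply/implyP => /H->.
Qed.

Lemma is_cutC D e : is_cut (~: D) e = is_cut D e.
Proof.
apply/is_cutP/is_cutP => H u v /H <-; rewrite !inE;
by case: (u \in D); case: (v \in D).
Qed.

Lemma cut_same D e u v :
  is_cut D e -> adj u v -> [set u; v] != e -> (u \in D) = (v \in D).
Proof.
by move=> /is_cutP H uv /negbTE ne; have := H _ _ uv; rewrite ne;
   case: (u \in D); case: (v \in D).
Qed.

Lemma cut_cross D e u v :
  is_cut D e -> adj u v -> (u \in D) != (v \in D) -> [set u; v] = e.
Proof.
by move=> /is_cutP H uv; have := H _ _ uv;
   case: (u \in D); case: (v \in D) => //= /esym/eqP.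
Qed.

Lemma cut_ends D u v :
  is_cut D [set u; v] -> adj u v -> (v \in D) = (u \notin D).
Proof.
by move=> /is_cutP H uv; have := H _ _ uv; rewrite eqxx;
   case: (u \in D); case: (v \in D).
Qed.

(** A path avoiding one end of [e] avoids [e]. *)
Lemma cut_const D e x u q :
    is_cut D e -> x \in e -> path (@adj G) u q -> x \notin u :: q ->
  {in u :: q, forall z, (z \in D) = (u \in D)}.
Proof.
move=> cD xe; elim: q u => [|v q IH] u /=.
  by move=> _ _ z; rewrite inE => /eqP->.
case/andP=> uv vq; rewrite inE negb_or => /andP[xu xq] z.
rewrite inE => /orP[/eqP-> //|zq]; rewrite (IH v vq xq z zq).
apply/esym/(cut_same cD uv); apply: contraNneq xq => E.
by move: xe; rewrite -E !inE (negbTE xu) /= => ->.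
Qed.

(** The cut is the component of an end of [e] in the graph without [e]; a path
    to the other end would close into a cycle through [e]. *)
Lemma acyclic_cut e : acyclic G -> e \in edges G -> exists D, is_cut D e.
Proof.
move=> acG /edgesP[a [b [ab ->]]].
set r := fun s t : G => adj s t && ([set s; t] != [set a; b]).
have rs : symmetric r by move=> s t; rewrite /r adj_sym setUC.
have bD : connect r a b = false.
  apply/negP => /connectP[p0 rp0 E0]; case/shortenP: rp0 E0 => p rp up _ E.
  have := acG (a :: p); rewrite /ucycle up /= rcons_path -E (adj_sym b) ab !andbT.
  have -> : path (@adj G) a p by apply: sub_path rp => s t /andP[].
  move=> /(_ isT); case: p rp up E => [|c [|c' p]] //= rp up E _.
    by move: ab; rewrite E adj_irr.
  by move: rp; rewrite -E /r eqxx andbF.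
exists [set z | connect r a z]; apply/is_cutP => u v uv; rewrite !inE.
case: eqVneq => [/eqP|ne].
  by rewrite eq_set2 => /orP[]/andP[/eqP-> /eqP->]; rewrite bD connect0.
have ruv : connect r u v by rewrite connect1 // /r uv ne.
by rewrite (same_connect_r (sym_connect_sym rs) ruv) addbb.
Qed.

End Cuts.

(** * Edges of a vertex sequence *)

Definition pedges (V : finType) (p : seq V) : seq {set V} :=
  [seq [set e.1; e.2] | e <- zip p (behead p)].

Section PathEdges.
Variable V : finType.
Implicit Types (x y u v : V) (e : {set V}) (p q : seq V).

Lemma pedges_cons x y p : pedges (x :: y :: p) = [set x; y] :: pedges (y :: p).
Proof. by []. Qed.

Lemma pedges_cat p x q : pedges (p ++ x :: q) = pedges (rcons p x) ++ pedges (x :: q).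
Proof.
elim: p => [|y [|z p] IH] //.
by rewrite -[LHS]/([set y; z] :: pedges ((z :: p) ++ x :: q)) IH.
Qed.

Lemma pedges_rcons p x y :
  pedges (rcons (rcons p x) y) = rcons (pedges (rcons p x)) [set x; y].
Proof. by rewrite -[in LHS]cats1 cat_rcons pedges_cat cats1. Qed.

Lemma pedges_rev p : pedges (rev p) = rev (pedges p).
Proof.
elim: p => [|x [|y p] IH] //; rewrite pedges_cons !rev_cons -IH !rev_cons.
by rewrite pedges_rcons setUC.
Qed.

Lemma pedgesP p e :
  reflect (exists p1 u v p2, p = p1 ++ u :: v :: p2 /\ e = [set u; v]) (e \in pedges p).
Proof.
apply: (iffP idP) => [|[p1 [u [v [p2 [-> ->]]]]]]; last first.
  by rewrite pedges_cat mem_cat pedges_cons mem_head orbT.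
elim: p => [|x [|y p] IH] //; rewrite pedges_cons inE => /orP[/eqP->|/IH].
  by exists [::], x, y, p.
by case=> p1 [u [v [p2 [-> ->]]]]; exists (x :: p1), u, v, p2.
Qed.

Lemma pedges_sub p e x : e \in pedges p -> x \in e -> x \in p.
Proof.
case/pedgesP => p1 [u [v [p2 [-> ->]]]]; rewrite !inE mem_cat !inE.
by case/orP=> ->; rewrite !orbT.
Qed.

Lemma pedges_adj (r : rel V) p u v :
  symmetric r -> sorted r p -> [set u; v] \in pedges p -> r u v.
Proof.
move=> rs rp /pedgesP[p1 [a [b [p2 [E /eqP]]]]]; move: rp; rewrite {}E.
case/cat_sorted2 => _ /= /andP[ab _].
by rewrite eq_set2 => /orP[]/andP[/eqP-> /eqP->] //; rewrite rs.
Qed.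

Lemma sorted_pedges (r : rel V) p :
  (forall u v, [set u; v] \in pedges p -> r u v) -> sorted r p.
Proof.
elim: p => [|x [|y p] IH] // H; rewrite /= H ?mem_head //=.
by apply: IH => u v uv; apply: H; rewrite pedges_cons inE uv orbT.
Qed.

Lemma cover_pedges p x y :
  cover [set:: pedges (x :: y :: p)] = [set z in x :: y :: p].
Proof.
apply/setP => z; rewrite [RHS]inE; apply/bigcupP/idP.
  by case=> e; rewrite inE => /pedges_sub; apply.
elim: p x y => [|t p IH] x y; rewrite inE => /orP[/eqP->|].
- by exists [set x; y]; rewrite !inE ?eqxx.
- by rewrite inE => /eqP->; exists [set x; y]; rewrite !inE ?eqxx ?orbT.
- by exists [set x; y]; rewrite !inE ?eqxx.
by case/IH => e; rewrite inE => He ze; exists e; rewrite // inE pedges_cons inE He orbT.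
Qed.

End PathEdges.

(** * Cuts of a tree *)

Section Trees.
Variable G : sgraph.
Implicit Types (x y u v : G) (e D F S : {set G}) (p q : seq G).

(** Along a cycle, the edges other than the first one would connect the two
    sides of its cut. *)
Lemma cuts_acyclic :
  (forall e, e \in edges G -> exists D, is_cut D e) -> acyclic G.
Proof.
move=> cuts c; rewrite leqNgt => /andP[]; case: c => [|x [|y p]] //= /andP[xy].
rewrite rcons_path => /andP[yp]; set z := last y p => zx xU; apply/negP => p0.
have [D cD] := cuts _ (introT (edgesP _) (ex_intro _ x (ex_intro _ y (conj xy erefl)))).
case/and3P: xU => xU yU _.
have zD : (z \in D) = (y \in D).
  by apply: (cut_const cD _ yp xU); rewrite ?set21 // mem_last.
have zy : z != y.
  by case: p p0 @z yU {yp zx zD xU} => //= a p _; apply: contraNneq => <-; exact: mem_last.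
have := cut_same cD zx; rewrite eq_set2 (negbTE zy) (negbTE (adj_neq xy)) andbF.
rewrite zD (cut_ends cD xy) => /(_ isT).
by case: (x \in D).
Qed.

(** One of the two complementary cuts of [e]. *)
Definition cut e : {set G} := odflt set0 [pick D | is_cut D e].

Hypothesis Gconn : connected_graph G.

Lemma closed_trivial D :
  (forall u v, adj u v -> u \in D -> v \in D) -> D = set0 \/ D = setT.
Proof.
move=> clD; case: (set_0Vmem D) => [->|[x xD]]; [by left | right].
apply/setP => y; rewrite inE.
have clD' : closed (@adj G) (mem D).
  apply: intro_closed; [exact: sym_connect_sym (@adj_sym G) | exact: clD].
by rewrite -(closed_connect clD' (Gconn x y)) xD.
Qed.

Lemma uncrossed D x :
  (forall u v, adj u v -> u \in D -> v \notin D -> False) ->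
  x \notin D -> D = set0.
Proof.
move=> H xD; have [u v uv uD|//|ET] := @closed_trivial D; last by rewrite ET inE in xD.
by case: (boolP (v \in D)) => // /(H _ _ uv uD).
Qed.

Lemma cut_uniq D F e : is_cut D e -> is_cut F e -> D = F \/ D = ~: F.
Proof.
move=> /is_cutP cD /is_cutP cF.
have [|E|E] := @closed_trivial [set z | (z \in D) (+) (z \in F)].
- move=> u v uv; rewrite !inE; have := cD _ _ uv; rewrite -(cF _ _ uv).
  by case: (u \in D); case: (v \in D); case: (u \in F); case: (v \in F).
- left; apply/setP => z; move/setP/(_ z): E; rewrite !inE.
  by case: (z \in D); case: (z \in F).
right; apply/setP => z; move/setP/(_ z): E; rewrite !inE.
by case: (z \in D); case: (z \in F).
Qed.

(** For two distinct edges, each lies on one side of the cut of the other, and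
    one of the four corners formed by the two cuts meets neither. Connectedness
    makes that corner empty. *)
Lemma cuts_laminar D F e f :
    is_cut D e -> is_cut F f -> e \in edges G -> f \in edges G ->
  [\/ D :&: F = set0, D \subset F, F \subset D | D :|: F = setT].
Proof.
move=> cD cF /edgesP[a [b [ab Ee]]] /edgesP[c [d [cd Ef]]].
have [efE|ef] := eqVneq e f.
  case: (cut_uniq cD (F := F)) => [|->|->]; rewrite ?efE //.
  - by apply: Or42.
  - by apply: Or41; rewrite setIC setICr.
(* The endpoints of each edge lie on one side of the other cut; the corner
   opposite to both is crossed by nothing. *)
have key D' F' : is_cut D' e -> is_cut F' f -> c \notin D' -> a \notin F' ->
    D' :&: F' = set0.
  move=> cD' cF' cD0 aF0.
  have dD0 : d \notin D' by rewrite -(cut_same cD' cd) // -Ef eq_sym.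
  have bF0 : b \notin F' by rewrite -(cut_same cF' ab) // -Ee.
  apply: (@uncrossed _ a); last by rewrite inE (negbTE aF0) andbF.
  move=> u v uv; rewrite !inE => /andP[uD uF]; rewrite negb_and => /orP[vN|vN].
    have := cut_cross cD' uv; rewrite uD (negbTE vN) => /(_ isT) E.
    have : u \in e by rewrite -E set21.
    by rewrite Ee !inE => /orP[]/eqP Eu; move: uF; rewrite Eu; apply/negP.
  have := cut_cross cF' uv; rewrite uF (negbTE vN) => /(_ isT) E.
  have : u \in f by rewrite -E set21.
  by rewrite Ef !inE => /orP[]/eqP Eu; move: uD; rewrite Eu; apply/negP.
case cD0: (c \in D); case aF0: (a \in F).
- apply: Or44; apply: setC_inj; rewrite setCU setCT.
  by apply: key; rewrite ?is_cutC // inE ?cD0 ?aF0.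
- apply: Or43; rewrite -[D]setCK -disjoints_subset -setI_eq0 setIC.
  by apply/eqP/key; rewrite ?is_cutC // ?inE ?cD0 ?aF0.
- apply: Or42; rewrite -[F]setCK -disjoints_subset -setI_eq0.
  by apply/eqP/key; rewrite ?is_cutC // ?inE ?cD0 ?aF0.
by apply: Or41; apply: key; rewrite ?cD0 ?aF0.
Qed.

Lemma path_edge_separates x q D e :
    path (@adj G) x q -> uniq (x :: q) -> e \in pedges (x :: q) -> is_cut D e ->
  (last x q \in D) = (x \notin D).
Proof.
elim: q x => [|v q IH] x //= /andP[xv vq] /andP[xU vU].
rewrite pedges_cons inE => /orP[/eqP->|eq] cD.
  rewrite (cut_const cD (set21 x v) vq xU) ?mem_last //.
  exact: cut_ends cD xv.
rewrite IH //; congr (~~ _); apply/esym/(cut_same cD xv).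
by apply: contraNneq xU => E; rewrite (pedges_sub eq) // -E set21.
Qed.

End Trees.

(** * Steiner distance in a tree *)

Section Steiner.
Variable G : sgraph.
Implicit Types (x y u v : G) (e D S : {set G}) (p q : seq G).

Definition splits D S := ~~ (S \subset D) && ~~ (S \subset ~: D).

Lemma splitsP D S :
  reflect (exists x y, [/\ x \in S, y \in S, x \in D & y \notin D]) (splits D S).
Proof.
apply: (iffP andP) => [[/subsetPn[y yS yD] /subsetPn[x xS xD]]|[x [y [xS yS xD yD]]]].
  by exists x, y; rewrite inE negbK in xD.
by split; apply/subsetPn; [exists y | exists x; rewrite // inE negbK].
Qed.

Variable C : {set G} -> {set G}.
Hypothesis Gconn : connected_graph G.
Hypothesis cutC : forall e, e \in edges G -> is_cut (C e) e.

Definition split_edges S : {set {set G}} := [set e in edges G | splits (C e) S].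

(** The vertices of [S] are added to those covered by the edges for the case of
    a singleton [S], which no cut splits. *)
Definition steiner_tree S : subgraph G := (S :|: cover (split_edges S), split_edges S).

Definition elink (E : {set {set G}}) : rel G := fun u v => [set u; v] \in E.

Lemma elink_sym E : symmetric (elink E).
Proof. by move=> u v; rewrite /elink setUC. Qed.

(** Every edge of the simple path between two vertices of [S] separates its
    ends. *)
Lemma split_edges_connect S x y :
  x \in S -> y \in S -> connect (elink (split_edges S)) x y.
Proof.
move=> xS yS; have /connectP[p0 xp0 Ey] := Gconn x y.
case/shortenP: xp0 Ey => p xp up _ Ey; apply/connectP; exists p => //.
rewrite -[path _ _ _]/(sorted (elink (split_edges S)) (x :: p)).
apply: sorted_pedges => u v uvp; have uv := pedges_adj (p := x :: p) (@adj_sym G) xp uvp.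
have uvE : [set u; v] \in edges G by rewrite edgeE.
rewrite /elink inE uvE; apply/splitsP.
have := path_edge_separates xp up uvp (cutC uvE); rewrite -Ey => E.
by case: (boolP (x \in C [set u; v])) E => xD /= yD; [exists x, y | exists y, x];
   rewrite xS yS yD // negbK.
Qed.

(** An end of a split edge is reached because the edge lies on the path between
    two vertices of [S] that its cut separates. *)
Lemma steiner_tree_connected S : S != set0 -> is_connected (steiner_tree S).
Proof.
case/set0Pn=> x0 x0S; set r := elink (split_edges S).
have rsym : connect_sym r := sym_connect_sym (@elink_sym _).
have reach z : z \in S :|: cover (split_edges S) -> connect r x0 z.
  rewrite inE => /orP[|/bigcupP[e eE ze]]; first exact: split_edges_connect.
  have [eG /splitsP[s [t [sS tS sD tD]]]] : e \in edges G /\ splits (C e) S.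
    by move: eE; rewrite inE => /andP[].
  apply: contraNT tD => x0z.
  have [q rq Eq] : exists2 q, path r s q & t = last s q.
    by apply/connectP; apply: split_edges_connect.
  have sub : subrel r (@adj G).
    by move=> u v; rewrite /r /elink inE edgeE => /andP[].
  rewrite Eq (cut_const (cutC eG) ze (sub_path sub rq)) ?mem_last //.
  apply: contra x0z => /(path_connect rq); apply: connect_trans.
  exact: split_edges_connect.
apply/andP; split; first by apply/set0Pn; exists x0; rewrite inE x0S.
apply/forall_inP => x xW; apply/forall_inP => y yW.
by apply: (connect_trans _ (reach y yW)); rewrite rsym reach.
Qed.

Lemma steiner_tree_subgraph S : is_subgraph (steiner_tree S).
Proof.
apply/andP; split; first by apply/subsetP => e; rewrite inE => /andP[].
by apply/forall_inP => e eE; rewrite (subset_trans _ (subsetUr _ _)) // bigcup_sup.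
Qed.

Lemma steiner_dist_le S : steiner_dist S <= #|edges G|.
Proof.
rewrite /steiner_dist; elim/big_rec: _ => // H m _.
exact: leq_trans (geq_minr _ _).
Qed.

(** The Steiner tree is an admissible subgraph; conversely a connected subgraph
    containing [S] has to cross every cut that splits [S], and the only edge
    available for that is the edge of the cut. *)
Lemma steiner_distE S : S != set0 -> steiner_dist S = #|split_edges S|.
Proof.
move=> S0; apply/eqP; rewrite eqn_leq /steiner_dist; apply/andP; split.
  rewrite -[#|split_edges S|]/#|(steiner_tree S).2|.
  apply: (@Order.TotalTheory.bigmin_le_cond _ nat _ _ (steiner_tree S)).
  by rewrite steiner_tree_subgraph steiner_tree_connected // subsetUl.
elim/big_rec: _ => [|H m /and3P[sH cH SH] IH].
  by apply: subset_leq_card; apply/subsetP => e; rewrite inE => /andP[].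
rewrite leq_min IH andbT subset_leq_card //; apply/subsetP => e.
rewrite inE => /andP[eG /splitsP[s [t [sS tS sD tD]]]].
have /andP[_ /forall_inP/(_ s (subsetP SH _ sS))/forall_inP/(_ t (subsetP SH _ tS))] := cH.
case/connectP=> q; elim: q s sD {sS} => [|v q IHq] s sD /= => [_ E|/andP[sv vq] Et].
  by rewrite E sD in tD.
have svG : adj s v by have /andP[/subsetP sHE _] := sH; rewrite -edgeE; apply: sHE.
case: (boolP (v \in C e)) => vD; first exact: IHq vD vq Et.
by rewrite -(cut_cross (cutC eG) svG) // sD (negbTE vD).
Qed.

End Steiner.

(** * The Steiner Wiener index as a sum over the edges *)

Section SteinerWiener.
Variable G : sgraph.
Implicit Types (e D S : {set G}).

Definition nsplits k D : nat := #|[set S : {set G} | (#|S| == k) && splits D S]|.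

Lemma SW_cuts (C : {set G} -> {set G}) k :
    connected_graph G -> (forall e, e \in edges G -> is_cut (C e) e) -> 0 < k ->
  SW G k = \sum_(e in edges G) nsplits k (C e).
Proof.
move=> Gconn cutC k0; rewrite /SW.
rewrite (eq_bigr (fun S => \sum_(e in edges G) splits (C e) S)) => [|S /eqP Sk].
  rewrite exchange_big; apply: eq_bigr => e _ /=; rewrite /nsplits -sum1_card.
  rewrite big_mkcond [RHS]big_mkcond; apply: eq_bigr => S _ /=; rewrite inE.
  by case: (#|S| == k); case: splits.
rewrite (steiner_distE Gconn cutC) -?card_gt0 ?Sk // -sum1_card.
rewrite big_mkcond [RHS]big_mkcond; apply: eq_bigr => e _ /=; rewrite inE.
by case: (e \in _); case: splits.
Qed.

(** A nonempty [k]-set is split by [D], contained in [D], or contained in its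
    complement, and these cases exclude each other. *)
Lemma nsplits_bin k D :
  0 < k -> nsplits k D + ('C(#|D|, k) + 'C(#|~: D|, k)) = 'C(#|G|, k).
Proof.
move=> k0; rewrite /nsplits -card_draws -!cards_draws -!sum1dep_card big_mkcond.
rewrite [X in _ + (X + _)]big_mkcond [X in _ + (_ + X)]big_mkcond [RHS]big_mkcond.
rewrite -!big_split; apply: eq_bigr => S _ /=.
rewrite /splits; case: eqP => [Sk|_]; rewrite ?andbF ?andbT //=.
case sD: (S \subset D); case sN: (S \subset ~: D) => //=.
have : S \subset D :&: ~: D by rewrite subsetI sD.
by rewrite setICr subset0 -cards_eq0 Sk; case: k k0 {Sk}.
Qed.

(** The increments of ['C(_, k)] are values of ['C(_, k.-1)], which is monotone. *)
Lemma bin_convex x y t k : x <= y -> 'C(x + t, k) + 'C(y, k) <= 'C(x, k) + 'C(y + t, k).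
Proof.
move=> xy; case: k => [|k]; first by rewrite !bin0.
elim: t => [|t IH]; first by rewrite !addn0.
have : 'C(x + t, k) <= 'C(y + t, k) by rewrite leq_bin2l // leq_add2r.
by rewrite !addnS !binS; lia.
Qed.

Lemma bin_convex_strict x y t :
  x < y -> 0 < t -> 'C(x + t, 2) + 'C(y, 2) < 'C(x, 2) + 'C(y + t, 2).
Proof.
move=> xy; case: t => // t _; have := bin_convex t 2 (ltnW xy).
by rewrite !addnS !binS !bin1; lia.
Qed.

Lemma nsplits_le k D D' :
  0 < k -> #|D| <= #|D'| -> #|D| + #|D'| <= #|G| -> nsplits k D <= nsplits k D'.
Proof.
move=> k0 le1 le2; have := nsplits_bin D k0; have := nsplits_bin D' k0.
have := @bin_convex #|D| (#|G| - #|D'|) (#|D'| - #|D|) k.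
have := cardsC D; have := cardsC D'; rewrite subnKC //.
have -> : #|G| - #|D'| + (#|D'| - #|D|) = #|G| - #|D| by lia.
move=> E1 E2; have -> : #|~: D| = #|G| - #|D| by lia.
have -> : #|~: D'| = #|G| - #|D'| by lia.
by lia.
Qed.

Lemma nsplits_lt D D' :
  #|D| < #|D'| -> #|D| + #|D'| < #|G| -> nsplits 2 D < nsplits 2 D'.
Proof.
move=> le1 le2; have := @nsplits_bin 2 D isT; have := @nsplits_bin 2 D' isT.
have := @bin_convex_strict #|D| (#|G| - #|D'|) (#|D'| - #|D|).
have := cardsC D; have := cardsC D'; rewrite subnKC ?(ltnW le1) //.
have -> : #|G| - #|D'| + (#|D'| - #|D|) = #|G| - #|D| by lia.
move=> E1 E2; have -> : #|~: D| = #|G| - #|D| by lia.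
have -> : #|~: D'| = #|G| - #|D'| by lia.
by lia.
Qed.

End SteinerWiener.

(** * Exchanging two edges *)

Section SwapEdge.
Variable V : finType.
Implicit Types (a b c d : V) (e : {set V}).

(** The bijection between the edge sets of two graphs that differ by replacing
    the edges [ab], [cd] by [ac], [bd]. Defined on all sets as an involution, it
    serves in both directions. *)
Definition swap_edge a b c d e : {set V} :=
  if e == [set a; b] then [set a; c] else if e == [set a; c] then [set a; b]
  else if e == [set c; d] then [set b; d] else if e == [set b; d] then [set c; d]
  else e.

Lemma uniq4_neq a b c d : uniq [:: a; b; c; d] ->
  (((a == b = false) * (b == a = false)) * ((a == c = false) * (c == a = false)) *
   ((a == d = false) * (d == a = false)) * ((b == c = false) * (c == b = false)) *
   ((b == d = false) * (d == b = false)) * ((c == d = false) * (d == c = false)))%type.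
Proof.
rewrite /= !inE !negb_or !andbT => /andP[/and3P[ab ac ad] /andP[/andP[bc bd] cd]].
by do ![split]; apply/negbTE; rewrite // eq_sym.
Qed.

Lemma swap_edgeK a b c d : uniq [:: a; b; c; d] -> involutive (swap_edge a b c d).
Proof.
move=> /uniq4_neq U e; rewrite /swap_edge.
case: (eqVneq e [set a; b]) => [->|ab]; first by rewrite !eq_set2 !eqxx !U.
case: (eqVneq e [set a; c]) => [->|ac]; first by rewrite !eqxx.
case: (eqVneq e [set c; d]) => [->|cd]; first by rewrite !eq_set2 !eqxx !U.
case: (eqVneq e [set b; d]) => [->|bd]; first by rewrite !eq_set2 !eqxx !U.
by rewrite !ifN.
Qed.

Lemma swap_edge_sym a b c d e : uniq [:: a; b; c; d] ->
  swap_edge a c b d e = swap_edge a b c d e.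
Proof.
move=> /uniq4_neq U; rewrite /swap_edge.
case: (eqVneq e [set a; b]) => [->|ab]; first by rewrite !eq_set2 !eqxx !U.
case: (eqVneq e [set a; c]) => [_|ac] //.
by case: (eqVneq e [set c; d]) => [->|cd] //; rewrite !eq_set2 !eqxx !U.
Qed.

Lemma swap_edge_rev a b c d e : uniq [:: a; b; c; d] ->
  swap_edge d c b a e = swap_edge a b c d e.
Proof.
move=> /uniq4_neq U; rewrite /swap_edge !(setUC [set d]).
rewrite (setUC [set b] [set a]) (setUC [set c] [set a]).
case: (eqVneq e [set a; b]) => [->|ab]; first by rewrite !eq_set2 !eqxx !U.
case: (eqVneq e [set a; c]) => [->|ac]; first by rewrite !eq_set2 !eqxx !U.
by case: (eqVneq e [set b; d]).
Qed.

Lemma swap_edge_id a b c d e :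
  e != [set a; b] -> e != [set a; c] -> e != [set c; d] -> e != [set b; d] ->
  swap_edge a b c d e = e.
Proof. by move=> *; rewrite /swap_edge !ifN. Qed.

Definition crossed (r : rel V) (D e : {set V}) :=
  forall u v, r u v -> (u \in D) (+) (v \in D) = ([set u; v] == e).

(** Two relations that differ by such an exchange, where [ab] and [cd] are
    bridges of [r] with [b], [c] between them: [A] is the part hanging at [a],
    and [Y] the part hanging at [d]. The same parts witness the inverse exchange,
    which makes the notion symmetric ([switched_sym]); it is also invariant under
    reading [a], [b], [c], [d] backwards ([switched_rev]). *)
Record switched (r r' : rel V) a b c d : Prop := Switched {
  sw_uniq : uniq [:: a; b; c; d];
  sw_ab : r a b; sw_cd : r c d; sw_ac : r' a c; sw_bd : r' b d;
  sw_keep : forall u v, [set u; v] != [set a; b] -> [set u; v] != [set a; c] ->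
    [set u; v] != [set c; d] -> [set u; v] != [set b; d] -> r u v = r' u v;
  sw_side : exists A Y : {set V},
    [/\ [/\ a \in A, b \notin A, c \notin A & d \notin A],
        [/\ a \notin Y, b \notin Y, c \notin Y & d \in Y],
        crossed r A [set a; b] /\ crossed r Y [set c; d] &
        crossed r' A [set a; c] /\ crossed r' Y [set b; d]] }.

Lemma switched_sym r r' a b c d : switched r r' a b c d -> switched r' r a c b d.
Proof.
case=> U ab cd ac bd keep [A [Y [[? ? ? ?] [? ? ? ?] [? ?] [? ?]]]]; split=> //.
- by have E := uniq4_neq U; rewrite /= !inE !E.
- by move=> u v ? ? ? ?; rewrite keep.
by exists A, Y.
Qed.

Lemma switched_rev r r' a b c d : symmetric r -> symmetric r' ->
  switched r r' a b c d -> switched r r' d c b a.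
Proof.
move=> rs rs' [U ab cd ac bd keep [A [Y [[? ? ? ?] [? ? ? ?] [? ?] [? ?]]]]].
split=> //; rewrite 1?rs 1?rs' //.
- by have := rev_uniq [:: a; b; c; d]; rewrite U.
- move=> u v; rewrite !(setUC [set d]) (setUC [set b] [set a]) (setUC [set c] [set a]).
  by move=> *; apply: keep.
by exists Y, A; rewrite !(setUC [set d]) (setUC [set b] [set a]) (setUC [set c] [set a]).
Qed.

Lemma switched_nonadj r r' a b c d :
  switched r r' a b c d -> (r a c = false) * (r b d = false).
Proof.
case=> /uniq4_neq U _ _ _ _ _ [A [Y [[aA bA cA dA] [aY bY cY dY] [cutA cutY] _]]].
split; apply/negP.
  by move/cutA; rewrite aA (negbTE cA) eq_set2 !eqxx !U.
by move/cutY; rewrite dY (negbTE bY) eq_set2 !eqxx !U.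
Qed.

(** The neighbourhood of each of the four vertices changes by a transposition,
    of [b] and [c] or of [a] and [d]. *)
Lemma switched_deg r r' a b c d u : symmetric r -> symmetric r' ->
  switched r r' a b c d -> #|[set y | r' u y]| = #|[set y | r u y]|.
Proof.
move=> rs rs' S.
have U := uniq4_neq (sw_uniq S).
have [ac bd] := switched_nonadj S; have [ab cd] := switched_nonadj (switched_sym S).
have [_ rab rcd rac rbd keep _] := S.
have deg_tperm x y : (forall z, r' u z = r u (tperm x y z)) ->
    #|[set z | r' u z]| = #|[set z | r u z]|.
  move=> E; rewrite -(card_preimset [set z | r u z] (@perm_inj _ (tperm x y))).
  by apply: eq_card => z; rewrite !inE E.
have deg_id : (forall z, r' u z = r u z) -> #|[set z | r' u z]| = #|[set z | r u z]|.
  by move=> E; apply: eq_card => z; rewrite !inE E.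
have [ua|ua] := eqVneq u a.
  apply: (deg_tperm b c) => z; rewrite {}ua.
  case: tpermP => [->|->|/eqP zb /eqP zc]; rewrite ?ab ?ac ?rab ?rac //.
  by rewrite keep //; rewrite ?eq_set2 ?eqxx ?U ?(negbTE zb) ?(negbTE zc) ?andbF.
have [ud|ud] := eqVneq u d.
  apply: (deg_tperm b c) => z; rewrite {}ud.
  case: tpermP => [->|->|/eqP zb /eqP zc]; rewrite (rs d) (rs' d) ?cd ?bd ?rcd ?rbd //.
  by rewrite keep //; rewrite ?eq_set2 ?eqxx ?U ?(negbTE zb) ?(negbTE zc) ?andbF.
have [ub|ub] := eqVneq u b.
  apply: (deg_tperm a d) => z; rewrite {}ub.
  case: tpermP => [->|->|/eqP zb /eqP zc]; rewrite ?(rs b a) ?(rs' b a) ?ab ?bd ?rab ?rbd //.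
  by rewrite keep //; rewrite ?eq_set2 ?eqxx ?U ?(negbTE zb) ?(negbTE zc) ?andbF.
have [uc|uc] := eqVneq u c.
  apply: (deg_tperm a d) => z; rewrite {}uc.
  case: tpermP => [->|->|/eqP zb /eqP zc]; rewrite ?(rs c a) ?(rs' c a) ?cd ?ac ?rcd ?rac //.
  by rewrite keep //; rewrite ?eq_set2 ?eqxx ?U ?(negbTE zb) ?(negbTE zc) ?andbF.
by apply: deg_id => z; rewrite keep // eq_set2 ?(negbTE ua) ?(negbTE ub) ?(negbTE uc) ?(negbTE ud)
  ?andbF.
Qed.
End SwapEdge.

(** * Segments under an exchange of edges *)

(** A segment without the condition on its ends, hence possibly extensible. *)
Definition chain (G : sgraph) (x : G) s y : bool :=
  [&& uniq (x :: rcons s y), path (@adj G) x (rcons s y) &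
      all (fun z => deg z == 2) s].

Lemma segment_pathE (G : sgraph) (x y : G) s :
  segment_path x s y = [&& chain x s y, leaf x || branch x & leaf y || branch y].
Proof. by rewrite /segment_path /chain -!andbA. Qed.

Lemma chain_rev (G : sgraph) (x y : G) s : chain y (rev s) x = chain x s y.
Proof.
have E : y :: rcons (rev s) x = rev (x :: rcons s y) by rewrite rev_cons rev_rcons.
have sE z t (w : G) : path (@adj G) z (rcons t w) = sorted (@adj G) (z :: rcons t w) by [].
rewrite /chain !sE E rev_uniq rev_sorted all_rev.
by rewrite (eq_sorted (e' := @adj G)) // => u v; apply: adj_sym.
Qed.

Lemma segment_path_rev (G : sgraph) (x y : G) s :
  segment_path y (rev s) x = segment_path x s y.
Proof. by rewrite !segment_pathE chain_rev (andbC (leaf y || _)). Qed.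

Lemma pedges_swap_ends (V : finType) (x y : V) s :
  pedges (y :: rcons (rev s) x) =i pedges (x :: rcons s y).
Proof. by move=> e; rewrite -rev_cons -rev_rcons pedges_rev mem_rev. Qed.

Section SegmentSwitch.
Variables (V : finType) (r r' : rel V).
Variables (rs : symmetric r) (ri : irreflexive r).
Variables (rs' : symmetric r') (ri' : irreflexive r').
Let G := SGraph rs ri.
Let G' := SGraph rs' ri'.

Lemma switched_degE a b c d u :
  switched r r' a b c d -> deg (u : G') = deg (u : G).
Proof. exact: switched_deg. Qed.

(** A segment using [ab] ends at the branch vertex [b], so it stays a segment
    when this end is replaced by [c]. The new end does not occur on it, because
    the rest of the segment stays in the part [A] hanging at [a]. *)
Lemma segment_switch_end a b c d (x y : G) s :
    switched r r' a b c d -> branch (b : G) -> branch (c : G) ->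
    segment_path x s y -> [set a; b] \in pedges (x :: rcons s y) ->
  exists x' s' y', segment_path (x' : G') s' y' /\
    pedges (x' :: rcons s' y') =i map (swap_edge a b c d) (pedges (x :: rcons s y)).
Proof.
move=> S bB cB; have U := uniq4_neq (sw_uniq S).
have degE u := switched_degE u S.
wlog -> : x s y / x = b => [wl|].
  move=> seg abE.
  have : b \in x :: rcons s y by rewrite (pedges_sub abE) // set22.
  rewrite inE mem_rcons inE orbA => /orP[/orP[]/eqP E|bs].
  - exact: wl.
  - have [|||x' [s' [y' [seg' E']]]] := wl y (rev s) x; rewrite ?segment_path_rev //.
      by rewrite pedges_swap_ends.
    exists x', s', y'; split=> // e; rewrite E'.
    by apply: eq_mem_map => f; rewrite pedges_swap_ends.
  have /and4P[_ _ /allP/(_ _ bs)/eqP b2 _] := seg.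
  by move: bB; rewrite /branch b2.
case/and4P=> ubt rbt /allP s2 /andP[_ yB] abE; set t := rcons s y in ubt rbt abE *.
have [t' Et] : exists t', t = a :: t'.
  case: t ubt abE {rbt} => [|h t'] // /andP[bt _].
  rewrite pedges_cons inE => /orP[|/pedges_sub/(_ (set22 _ _)) bt']; last by rewrite bt' in bt.
  by rewrite eq_set2 !U eqxx andbT /= => /eqP <-; exists t'.
move: ubt rbt; rewrite Et => /andP[bt ut] /andP[_ rt].
have [A [_ [[aA bA cA dA] _ [cutA _] _]]] := sw_side S.
have ct : c \notin a :: t'.
  have cutA' : @is_cut G A [set a; b] by apply/is_cutP.
  apply/negP => ct; move: cA.
  by rewrite (cut_const cutA' (set22 a b) rt bt ct) aA.
have bc_fix e : e \in pedges (a :: t') ->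
    [/\ e != [set a; b], e != [set a; c], e != [set c; d] & e != [set b; d]].
  move=> et; split; [apply: contraNneq bt | apply: contraNneq ct |
                     apply: contraNneq ct | apply: contraNneq bt];
  by move=> E; rewrite (pedges_sub et) // E !inE eqxx ?orbT.
exists c, s, y; rewrite -/t Et; split.
  apply/and4P; split; rewrite -/t ?Et.
  - by rewrite /= in ut *; rewrite ct.
  - rewrite /= (rs' c) (sw_ac S) -[path _ _ _]/(sorted r' (a :: t')).
    apply: sorted_pedges => u v uv; have [? ? ? ?] := bc_fix _ uv.
    by rewrite -(sw_keep S) //; apply: pedges_adj uv.
  - by apply/allP => u /s2; rewrite degE.
  by rewrite /leaf /branch !degE in cB yB *; rewrite cB orbT.
rewrite !pedges_cons map_cons.
have -> : swap_edge a b c d [set b; a] = [set c; a].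
  by rewrite /swap_edge (setUC [set b]) eqxx setUC.
rewrite (_ : map _ _ = pedges (a :: t')) //.
rewrite -[RHS]map_id; apply/eq_in_map => e /bc_fix[? ? ? ?].
exact: swap_edge_id.
Qed.

Lemma segment_switch a b c d (x y : G) s :
    switched r r' a b c d -> branch (b : G) -> branch (c : G) ->
    segment_path x s y ->
  exists x' s' y', segment_path (x' : G') s' y' /\
    pedges (x' :: rcons s' y') =i map (swap_edge a b c d) (pedges (x :: rcons s y)).
Proof.
move=> S bB cB seg; have U := sw_uniq S.
have [abE|abE] := boolP ([set a; b] \in pedges (x :: rcons s y)).
  exact: (segment_switch_end S).
have [cdE|cdE] := boolP ([set c; d] \in pedges (x :: rcons s y)).
  have [|x' [s' [y' [seg' E]]]] := segment_switch_end (switched_rev rs rs' S) cB bB seg.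
    by rewrite setUC.
  exists x', s', y'; split=> // e; rewrite E; congr (_ \in _).
  by apply: eq_map => f; rewrite swap_edge_rev.
have [ac bd] := switched_nonadj S.
have fixE e : e \in pedges (x :: rcons s y) ->
    [/\ e != [set a; b], e != [set a; c], e != [set c; d] & e != [set b; d]].
  have /and4P[_ rp _ _] := seg.
  have padj u v := @pedges_adj _ r (x :: rcons s y) u v rs rp.
  move=> eE; split; apply: contraTneq eE => ->; rewrite ?abE ?cdE //.
    by apply/negP => /padj; rewrite ac.
  by apply/negP => /padj; rewrite bd.
exists x, s, y; split; last first.
  move=> e; rewrite (_ : map _ _ = pedges (x :: rcons s y)) //.
  rewrite -[RHS]map_id; apply/eq_in_map => f /fixE[? ? ? ?].
  exact: swap_edge_id.
case/and4P: seg => us rp s2 xyB; apply/and4P; split=> //.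
- rewrite -[path _ _ _]/(sorted r' (x :: rcons s y)).
  apply: sorted_pedges => u v uv; have [? ? ? ?] := fixE _ uv.
  by rewrite -(sw_keep S) //; apply: pedges_adj uv.
- by apply/allP => u /(allP s2); rewrite (switched_degE _ S).
by move: xyB; rewrite /leaf /branch !(switched_degE _ S).
Qed.

End SegmentSwitch.

Lemma segmentsP (G : sgraph) (H : subgraph G) :
  reflect (exists x s y, segment_path x s y /\ H = path_subgraph (x :: rcons s y))
          (H \in segments G).
Proof.
rewrite inE; apply: (iffP existsP) => [[x /existsP[y /existsP[n /existsP[s /andP[seg /eqP->]]]]]|].
  by exists x, s, y.
case=> x [s [y [seg ->]]]; exists x; apply/existsP; exists y.
have sG : size s < #|G|.
  have /and4P[us _ _ _] := seg; have := max_card (mem (x :: rcons s y)).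
  by rewrite (card_uniqP us) /= size_rcons; apply: ltnW.
apply/existsP; exists (Ordinal sG); apply/existsP; exists (in_tuple s).
by rewrite seg /=.
Qed.

(** A segment has at least one edge, so it is determined by its edge set. *)
Definition spanned (G : sgraph) (E : {set {set G}}) : subgraph G := (cover E, E).

Lemma path_subgraph_spanned (G : sgraph) (x y : G) s :
  path_subgraph (x :: rcons s y) = spanned [set:: pedges (x :: rcons s y)].
Proof. by rewrite /spanned; case: s => [|z s] /=; rewrite cover_pedges. Qed.

Lemma switch_segments (V : finType) (a b c d : V) (r r' : rel V) rs ri rs' ri' H :
    let G := @SGraph V r rs ri in let G' := @SGraph V r' rs' ri' in
    switched r r' a b c d -> branch (b : G) -> branch (c : G) ->
  H \in segments G -> spanned (swap_edge a b c d @: H.2 : {set {set G'}}) \in segments G'.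
Proof.
move=> G G' S bB cB /segmentsP[x [s [y [seg ->]]]]; apply/segmentsP.
have [x' [s' [y' [seg' E]]]] := segment_switch rs' ri' S bB cB seg.
exists x', s', y'; split=> //; rewrite [RHS]path_subgraph_spanned; congr spanned.
apply/setP => e; rewrite [RHS]inE E; apply/imsetP/mapP => -[f fE ->].
  by exists f => //; rewrite inE in fE.
by exists f; rewrite // inE.
Qed.

Lemma switch_segment_sequence (V : finType) (a b c d : V) (r r' : rel V) rs ri rs' ri' :
    let G := @SGraph V r rs ri in let G' := @SGraph V r' rs' ri' in
    switched r r' a b c d -> branch (b : G) -> branch (c : G) ->
  segment_sequence G' = segment_sequence G.
Proof.
move=> G G' S bB cB.
set phi := swap_edge a b c d; have phiK : involutive phi := swap_edgeK (sw_uniq S).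
pose Phi (H : subgraph G) : subgraph G' := spanned (phi @: H.2 : {set {set G'}}).
have phi2 (E : {set {set V}}) : phi @: (phi @: E) = E.
  by rewrite -imset_comp (eq_imset _ phiK) imset_id.
have span (H : subgraph G') : H \in segments G' -> H = spanned H.2.
  by case/segmentsP => x [s [y [_ ->]]]; rewrite path_subgraph_spanned.
have spanG (H : subgraph G) : H \in segments G -> H = spanned H.2.
  by case/segmentsP => x [s [y [_ ->]]]; rewrite path_subgraph_spanned.
apply/perm_sortP.
- by move=> x y; apply: leq_total.
- by move=> x y z; rewrite /geq /=; lia.
- by move=> x y; rewrite /geq /=; lia.
have -> : [seq #|H.2| | H : subgraph G <- enum (segments G)] =
          [seq #|H.2| | H : subgraph G' <- [seq Phi H | H <- enum (segments G)]].
  rewrite -map_comp; apply: eq_map => H /=.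
  by rewrite card_imset //; apply: inv_inj.
apply: perm_map; apply: uniq_perm; first exact: enum_uniq.
  rewrite map_inj_in_uniq ?enum_uniq // => H1 H2; rewrite !mem_enum => H1S H2S [_ E].
  by rewrite (spanG _ H1S) (spanG _ H2S) -(phi2 H1.2) E phi2.
move=> H; rewrite mem_enum; apply/idP/mapP => [HS|[H0 + ->]]; last first.
  by rewrite mem_enum; apply: switch_segments.
have degE u : deg (u : G') = deg (u : G) := switched_deg u rs rs' S.
have bB' : branch (b : G') by rewrite /branch degE.
have cB' : branch (c : G') by rewrite /branch degE.
have := switch_segments rs ri (switched_sym S) cB' bB' HS => /= H0S.
exists (spanned (swap_edge a c b d @: H.2 : {set {set G}})); first by rewrite mem_enum.
rewrite (span _ HS) /Phi /= (eq_imset _ (fun e => swap_edge_sym e (sw_uniq S))).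
by rewrite phi2.
Qed.

(** * Exchanging two edges of a tree *)

Lemma sum_involution (I : finType) (P Q : pred I) (F : I -> nat) (h : I -> I) :
  involutive h -> (forall i, P i = Q (h i)) ->
  \sum_(i | P i) F (h i) = \sum_(i | Q i) F i.
Proof.
move=> hK PQ; rewrite (reindex_inj (inv_inj hK)).
by apply: eq_big => i; rewrite ?PQ hK.
Qed.

(** [A] and [Y] are the sides of [ab] and [cd] that hang at [a] and [d]. *)
Section Switching.
Variables (V : finType) (r : rel V) (rs : symmetric r) (ri : irreflexive r).
Let G := SGraph rs ri.
Hypotheses (Gconn : connected_graph G)
           (Gcut : forall e, e \in edges G -> is_cut (cut e : {set G}) e).
Variables (a b c d : V) (A Y : {set V}).
Hypotheses (ab : r a b) (cd : r c d) (bc : b != c).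
Hypotheses (cutA : @is_cut G A [set a; b]) (aA : a \in A) (cA : c \notin A).
Hypotheses (cutY : @is_cut G Y [set c; d]) (dY : d \in Y) (bY : b \notin Y).
Let phi := swap_edge a b c d.

Let bA : b \notin A.
Proof. by rewrite (cut_ends (G := G) cutA ab) aA. Qed.

Let cY : c \notin Y.
Proof. by have := cut_ends (G := G) cutY cd; rewrite dY; case: (c \in Y). Qed.

Let dA : d \notin A.
Proof.
rewrite -(cut_same (G := G) cutA cd) // eq_set2 negb_or (eq_sym c b) (negbTE bc) andbT.
by apply: contraNN cA => /andP[/eqP->].
Qed.

Let aY : a \notin Y.
Proof.
rewrite (cut_same (G := G) cutY ab) // eq_set2 negb_or (negbTE bc) andbF andbT.
by apply: contraNN cA => /andP[/eqP<-].
Qed.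

Let U : uniq [:: a; b; c; d].
Proof.
rewrite /= !inE !negb_or bc (adj_neq (G := G) ab) (adj_neq (G := G) cd) !andbT /= -!andbA.
apply/and3P; split; [apply: contraNneq cA | apply: contraNneq aY | apply: contraNneq bY].
- by move=> <-.
- by move=> ->.
by move=> ->.
Qed.

Let phiK : involutive phi := swap_edgeK U.

Let ac : r a c = false.
Proof.
apply/negP => /(is_cutP _ _ cutA); rewrite aA (negbTE cA) eq_set2 !eqxx.
by rewrite !(uniq4_neq U).
Qed.

Let bd : r b d = false.
Proof.
apply/negP => /(is_cutP _ _ cutY); rewrite dY (negbTE bY) eq_set2 !eqxx.
by rewrite !(uniq4_neq U).
Qed.

Definition switch_rel u v := (u != v) && (phi [set u; v] \in edges G).

Lemma switch_rel_sym : symmetric switch_rel.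
Proof. by move=> u v; rewrite /switch_rel eq_sym setUC. Qed.

Lemma switch_rel_irr : irreflexive switch_rel.
Proof. by move=> u; rewrite /switch_rel eqxx. Qed.

Definition switch : sgraph := SGraph switch_rel_sym switch_rel_irr.

Let abE : [set a; b] \in edges G. Proof. by rewrite (edgeE (G := G)). Qed.
Let cdE : [set c; d] \in edges G. Proof. by rewrite (edgeE (G := G)). Qed.

Let phi_ab : phi [set a; b] = [set a; c].
Proof. by rewrite /phi /swap_edge eqxx. Qed.

Let phi_cd : phi [set c; d] = [set b; d].
Proof. by rewrite /phi /swap_edge !eq_set2 !eqxx !(uniq4_neq U). Qed.

Lemma switch_ac : switch_rel a c.
Proof. by rewrite /switch_rel (uniq4_neq U) -phi_ab phiK. Qed.

Lemma switch_bd : switch_rel b d.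
Proof. by rewrite /switch_rel (uniq4_neq U) -phi_cd phiK. Qed.

Lemma switch_keep u v :
    [set u; v] != [set a; b] -> [set u; v] != [set a; c] ->
    [set u; v] != [set c; d] -> [set u; v] != [set b; d] ->
  r u v = switch_rel u v.
Proof.
move=> *; rewrite /switch_rel /phi swap_edge_id // (edgeE (G := G)) /=.
have [uv|_] := boolP (r u v); last by rewrite andbF.
by rewrite (adj_neq (G := G) uv).
Qed.

Lemma switch_old u v :
  r u v -> [set u; v] != [set a; b] -> [set u; v] != [set c; d] -> switch_rel u v.
Proof.
move=> uv N1 N2; rewrite -switch_keep //.
  by apply/eqP => E; move: uv; rewrite -[r u v]/(@adj G u v) -edgeE E (edgeE (G := G)) /= ac.
by apply/eqP => E; move: uv; rewrite -[r u v]/(@adj G u v) -edgeE E (edgeE (G := G)) /= bd.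
Qed.

Lemma mem_switch_edges f : (f \in edges switch) = (phi f \in edges G).
Proof.
apply/edgesP/idP => [[u [v [/andP[_ uvE] ->]]] //|fE].
suff [u [v [uv E]]] : exists u v, u != v /\ f = [set u; v].
  by exists u, v; rewrite /= /switch_rel uv -E.
case/edgesP: (fE) => u [v [uv E]].
rewrite -(phiK f) E /phi /swap_edge.
have [ab' ac'] : a != b /\ a != c by rewrite !(uniq4_neq U).
have [bd' cd'] : b != d /\ c != d by rewrite !(uniq4_neq U).
case: eqP => _; first by exists a, c.
case: eqP => _; first by exists a, b.
case: eqP => _; first by exists b, d.
case: eqP => _; first by exists c, d.
by exists u, v; rewrite (adj_neq uv).
Qed.

Lemma switch_connected : connected_graph switch.
Proof.
have csym : connect_sym switch_rel := sym_connect_sym switch_rel_sym.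
have bc' : connect switch_rel b c.
  have /connectP[p0 bp0 E0] := Gconn b c; case/shortenP: bp0 E0 => p bp up _ Ec.
  apply/connectP; exists p => //.
  rewrite -[path _ _ _]/(sorted switch_rel (b :: p)); apply: sorted_pedges => u v uv.
  apply: switch_old; first exact: (pedges_adj (p := b :: p)) rs bp uv.
    apply/eqP => E; rewrite E in uv.
    have := path_edge_separates (G := G) bp up uv cutA.
    by rewrite -Ec (negbTE cA) (negbTE bA).
  apply/eqP => E; rewrite E in uv.
  have := path_edge_separates (G := G) bp up uv cutY.
  by rewrite -Ec (negbTE cY) (negbTE bY).
have key u v : r u v -> connect switch_rel u v.
  move=> uv; have [/eqP|N1] := eqVneq [set u; v] [set a; b].
    have abC : connect switch_rel a b.
      by apply: connect_trans (connect1 switch_ac) _; rewrite csym.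
    by rewrite eq_set2 => /orP[]/andP[/eqP-> /eqP->] //; rewrite csym.
  have [/eqP|N2] := eqVneq [set u; v] [set c; d].
    have cdC : connect switch_rel c d.
      by rewrite csym; apply: connect_trans bc'; rewrite csym connect1 ?switch_bd.
    by rewrite eq_set2 => /orP[]/andP[/eqP-> /eqP->] //; rewrite csym.
  by rewrite connect1 ?switch_old.
by move=> x y; apply: (connect_sub (e := r)) => //; exact: Gconn.
Qed.

(** A cut that separates [b] from [c] gives up the part hanging on one of them
    and receives the part hanging on the other. The exclusive or with [A] and
    [Y] expresses this whichever side of the cut [b] is on. *)
Definition switch_cut (D : {set V}) : {set V} :=
  if (b \in D) == (c \in D) then D
  else [set z | (z \in D) (+) (z \in A :|: Y)].

(** When [D] does not separate [b] from [c], the new edges cross it exactly when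
    the old ones did. Otherwise moving an end of [ab] from [b] to [c] changes
    whether the edge crosses, and so does adding [A]; likewise for [cd]. *)
Lemma switch_is_cut e D :
  is_cut (D : {set G}) e -> is_cut (switch_cut D : {set switch}) (phi e).
Proof.
move=> /is_cutP cD; apply/is_cutP => u v /andP[uv gE].
rewrite -(inv_eq phiK); have Dab := cD a b ab; have Dcd := cD c d cd.
have AYab := (negbTE bA, negbTE cA, negbTE dA, negbTE aY, negbTE bY, negbTE cY, aA, dY).
have E1 x y : [set u; v] = [set x; y] ->
    (u \in switch_cut D) (+) (v \in switch_cut D) =
    (x \in switch_cut D) (+) (y \in switch_cut D).
  move/eqP; rewrite eq_set2 => /orP[]/andP[/eqP-> /eqP->] //; exact: addbC.
have [E|Nab] := eqVneq [set u; v] [set a; b].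
  by move: gE; rewrite E phi_ab (edgeE (G := G)) /= ac.
have [E|Ncd] := eqVneq [set u; v] [set c; d].
  by move: gE; rewrite E phi_cd (edgeE (G := G)) /= bd.
have [E|Nac] := eqVneq [set u; v] [set a; c].
  rewrite (E1 _ _ E) E -phi_ab phiK -Dab /switch_cut.
  case: ifP; rewrite ?inE ?AYab /=;
  by case: (a \in D); case: (b \in D); case: (c \in D).
have [E|Nbd] := eqVneq [set u; v] [set b; d].
  rewrite (E1 _ _ E) E -phi_cd phiK -Dcd /switch_cut.
  case: ifP; rewrite ?inE ?AYab /=;
  by case: (d \in D); case: (b \in D); case: (c \in D).
move: gE; rewrite /phi swap_edge_id // (edgeE (G := G)) => uvr.
rewrite -(cD _ _ uvr) /switch_cut; case: ifP => // _; rewrite !inE.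
rewrite (cut_same (G := G) cutA uvr) // (cut_same (G := G) cutY uvr) //.
by case: (_ || _); case: (u \in D); case: (v \in D).
Qed.

Lemma switch_tree : is_tree switch.
Proof.
split.
  apply/andP; split; first by apply/set0Pn; exists a; rewrite inE.
  apply/forall_inP => x _; apply/forall_inP => y _.
  by rewrite (eq_connect (@edgeE switch)); apply: switch_connected.
apply: cuts_acyclic => f; rewrite mem_switch_edges => fE.
exists (switch_cut (cut (phi f : {set G}))).
by rewrite -[f in is_cut _ f]phiK; apply/switch_is_cut/Gcut.
Qed.

Lemma SW_switch k : 0 < k ->
  SW switch k = \sum_(e in edges G) nsplits k (switch_cut (cut e) : {set G}).
Proof.
move=> k0; pose C (f : {set switch}) : {set switch} := switch_cut (cut (phi f : {set G})).
have cutC f : f \in edges switch -> is_cut (C f) f.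
  rewrite mem_switch_edges => fE.
  by rewrite -[f in is_cut _ f]phiK; apply/switch_is_cut/Gcut.
transitivity (\sum_(f in edges switch) nsplits k (C f)).
  exact: SW_cuts switch_connected cutC k0.
exact: (@sum_involution {set V} _ _ _ _ phiK mem_switch_edges).
Qed.

Lemma switch_switched : switched r switch_rel a b c d.
Proof.
split; rewrite ?switch_ac ?switch_bd //; first exact: switch_keep.
have cutA' := switch_is_cut cutA.
rewrite /switch_cut (negbTE bA) (negbTE cA) eqxx phi_ab in cutA'.
have cutY' := switch_is_cut cutY.
rewrite /switch_cut (negbTE bY) (negbTE cY) eqxx phi_cd in cutY'.
exists A, Y; split=> //; split.
- by move/is_cutP: cutA.
- by move/is_cutP: cutY.
- by move/is_cutP: cutA'.
by move/is_cutP: cutY'.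
Qed.

End Switching.

(** The sizes of a cut of [d] vertices before and after it gives up [p] vertices
    and receives [x2]; the form of the conclusion is the one produced by
    [cardsU] and [cardsD]. *)
Lemma switch_arith n d p x1 x2 x3 :
    x1 + x2 + x3 < n -> x1 <= x2 -> x2 <= x3 -> 0 < p -> p < x1 -> p <= d -> d <= x1 ->
  d < d - p + x2 - 0 /\ d + (d - p + x2 - 0) < n.
Proof. lia. Qed.

(** * The gain of an exchange at a tripod *)

Section Laminar.
Variable G : sgraph.
Hypotheses (Gconn : connected_graph G).
Variables (D F e f : {set G}).
Hypotheses (cD : is_cut D e) (cF : is_cut F f) (eE : e \in edges G) (fE : f \in edges G).

Lemma cuts_disjoint x y z :
    x \in D -> x \notin F -> y \in F -> y \notin D -> z \notin D -> z \notin F ->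
  [disjoint D & F].
Proof.
move=> xD xF yF yD zD zF.
case: (cuts_laminar Gconn cD cF eE fE) => [/eqP|/subsetP/(_ x xD)|/subsetP/(_ y yF)|E].
- by rewrite setI_eq0.
- by rewrite (negbTE xF).
- by rewrite (negbTE yD).
by have := in_setT z; rewrite -E inE (negbTE zD) (negbTE zF).
Qed.

Lemma cuts_subset x y z :
    x \in D -> x \in F -> y \in F -> y \notin D -> z \notin D -> z \notin F ->
  D \subset F.
Proof.
move=> xD xF yF yD zD zF.
case: (cuts_laminar Gconn cD cF eE fE) => [E|//|/subsetP/(_ y yF)|E].
- by have := in_set0 x; rewrite -E inE xD xF.
- by rewrite (negbTE yD).
by have := in_setT z; rewrite -E inE (negbTE zD) (negbTE zF).
Qed.

End Laminar.

Lemma nsplitsC (G : sgraph) k (D : {set G}) : nsplits k (~: D) = nsplits k D.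
Proof. by apply: eq_card => S; rewrite !inE /splits setCK (andbC (~~ (S \subset ~: D))). Qed.

Lemma switch_cutC (V : finType) (b c : V) A Y D :
  switch_cut b c A Y (~: D) = ~: switch_cut b c A Y D.
Proof.
rewrite /switch_cut !inE; case: (b \in D); case: (c \in D) => //=;
by apply/setP => z; rewrite !inE addNb.
Qed.

(** The cut of the edge [uv] on the side of [u]. *)
Definition oriented_cut (G : sgraph) (D : {set G}) u v :=
  [/\ is_cut D [set u; v], u \in D & v \notin D].

Lemma oriented_cutP (G : sgraph) (u v : G) :
  (forall e : {set G}, e \in edges G -> is_cut (cut e) e) -> adj u v ->
  exists D, oriented_cut D u v.
Proof.
move=> Gcut uv; have cD : is_cut (cut [set u; v]) [set u; v].
  by apply: Gcut; rewrite edgeE.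
have E := cut_ends cD uv.
have [uD|uD] := boolP (u \in cut [set u; v]).
  by exists (cut [set u; v]); split; rewrite // E uD.
by exists (~: cut [set u; v]); split; rewrite ?is_cutC // inE ?E ?uD.
Qed.

Lemma is_tree_cuts (G : sgraph) :
  is_tree G -> connected_graph G /\
    forall e : {set G}, e \in edges G -> is_cut (cut e) e.
Proof.
case=> Gw Gac; split; first exact: connected_whole.
move=> e eE; rewrite /cut; case: pickP => [D|no] //=.
by have [D cD] := acyclic_cut Gac eE; rewrite no in cD.
Qed.

(** [y] is the centre of the tripod; the exchange takes place along the path from
    [y] to a branch vertex [w] in the smallest part [X1] hanging at [y]. *)
Section Tripod.
Variables (V : finType) (r : rel V) (rs : symmetric r) (ri : irreflexive r).
Let G := SGraph rs ri.
Hypothesis Gtree : is_tree G.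
Variables (y x1 x2 x3 w : G) (X1 X2 X3 : {set G}).
Hypotheses (x1y : adj x1 y) (x2y : adj x2 y) (x3y : adj x3 y).
Hypotheses (x12 : x1 != x2) (x13 : x1 != x3) (x23 : x2 != x3).
Hypotheses (cX1 : oriented_cut X1 x1 y) (cX2 : oriented_cut X2 x2 y)
           (cX3 : oriented_cut X3 x3 y).
Hypotheses (le12 : #|X1| <= #|X2|) (le23 : #|X2| <= #|X3|).
Hypotheses (wX1 : w \in X1) (wB : branch w).

Let Gconn : connected_graph G := (is_tree_cuts Gtree).1.
Let Gcut := (is_tree_cuts Gtree).2.

Lemma sibling_cuts_disjoint (y' x x' : G) X X' :
  adj x y' -> adj x' y' -> x != x' -> oriented_cut X x y' -> oriented_cut X' x' y' ->
  [disjoint X & X'].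
Proof.
move=> xy xy' xx' [cX xX yX] [cX' xX' yX'].
have NE u v : u != v -> adj u y' -> [set u; y'] != [set v; y'].
  by move=> uv uy; rewrite eq_set2 negb_or !negb_and uv (adj_neq uy).
apply: (cuts_disjoint Gconn cX cX' _ _ xX _ xX' _ yX yX'); rewrite ?edgeE //.
  by rewrite (cut_same cX' xy) // NE.
by rewrite (cut_same cX xy') // NE // eq_sym.
Qed.

Let disj12 : [disjoint X1 & X2] := sibling_cuts_disjoint x1y x2y x12 cX1 cX2.
Let disj13 : [disjoint X1 & X3] := sibling_cuts_disjoint x1y x3y x13 cX1 cX3.
Let disj23 : [disjoint X2 & X3] := sibling_cuts_disjoint x2y x3y x23 cX2 cX3.

Let yX1 : y \notin X1. Proof. by case: cX1. Qed.

Let yB : branch y.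
Proof.
rewrite /branch /deg (leq_trans _ (subset_leq_card (A := [set x1; x2; x3]) _)) //.
  by rewrite -setUA cardsU1 cards2 !inE negb_or x12 x13 x23.
by apply/subsetP => x; rewrite !inE => /orP[/orP[]|]/eqP->; rewrite adj_sym.
Qed.

Let wy : w != y.
Proof. by apply: contraNneq yX1 => <-. Qed.

(** The parts hanging at two neighbours of [w] are disjoint, so at most one of
    them contains [y]. *)
Lemma branch_away : exists v Y, [/\ adj v w, oriented_cut Y v w & y \notin Y].
Proof.
have /card_gt1P[v [v' [+ + vv']]] : 1 < #|[set z | adj w z]| by apply: ltnW.
rewrite !inE adj_sym (adj_sym w) => vw vw'.
have [Y cY] := oriented_cutP Gcut vw; have [Y' cY'] := oriented_cutP Gcut vw'.
have [yY|yY] := boolP (y \in Y); last by exists v, Y.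
exists v', Y'; split=> //.
by rewrite (disjointFr (sibling_cuts_disjoint vw vw' vv' cY cY') yY).
Qed.

Let sizes : #|X1| + #|X2| + #|X3| < #|G|.
Proof.
rewrite -cardsT; apply: leq_ltn_trans (proper_card (A := X1 :|: X2 :|: X3) _).
  have := disj12; have := disj13; have := disj23; rewrite -!setI_eq0.
  move=> /eqP E23 /eqP E13 /eqP E12.
  by rewrite cardsU setIUl E13 E23 setU0 cards0 cardsU E12 cards0 !subn0.
rewrite properE subsetT; apply/subsetPn; exists y; rewrite // !inE.
by case: cX1 cX2 cX3 => _ _ /negbTE-> [_ _ /negbTE->] [_ _ /negbTE->].
Qed.

(** The exchange of [X2] with [Y]. An edge whose cut separates [y] from [w] has
    its [w]-side [D] between [Y] and [X1], so the new side [D :\: Y :|: X2] is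
    larger, and since #|X1| <= #|X3| the sizes of the two add up to less than the
    order of the tree. The cut [X1] is among those that change, which makes the
    increase for [k = 2] strict. *)
Lemma tripod_improves :
  exists G' : sgraph, [/\ is_tree G', segment_sequence G' = segment_sequence G,
    forall k, 0 < k -> SW G k <= SW G' k & SW G 2 < SW G' 2].
Proof.
have [v [Y [vw cYo yY]]] := branch_away; have [cY vY wY] := cYo.
have [cA aA bA] := cX2; have [cX xX _] := cX1.
have wX2 : w \notin X2 by rewrite (disjointFr disj12 wX1).
have wv : r w v by rewrite rs.
have cY' : is_cut Y [set w; v] by rewrite setUC.
have yw : y != w by rewrite eq_sym.
have NEvw : [set w; v] != [set x1; y].
  rewrite eq_set2 negb_or !negb_and wy andbT; apply/orP; right.
  by apply: contraNneq yY => <-.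
have vX1 : v \in X1 by rewrite -(cut_same cX (v := v) wv).
have YX1 : Y \subset X1.
  by apply: (cuts_subset Gconn cY cX _ _ vY vX1 wX1 wY yY yX1); rewrite ?edgeE.
have Yw : #|Y| < #|X1| by apply: proper_card; apply/properP; split=> //; exists w.
have Y0 : 0 < #|Y| by apply/card_gt0P; exists v.
pose G' := switch rs ri x2 y w v.
have gain D e : e \in edges G -> is_cut D e -> w \in D -> y \notin D ->
    #|D| < #|switch_cut y w X2 Y D| /\ #|D| + #|switch_cut y w X2 Y D| < #|G|.
  move=> eE cD wD yD.
  have DX1 : D \subset X1.
    have [ex1|ex1] := eqVneq e [set x1; y].
      case: (cut_uniq Gconn cD (F := X1)) => [|->//|ED]; first by rewrite ex1.
      by rewrite ED inE wX1 in wD.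
    have [x1D|x1D] := boolP (x1 \in D).
      by move: yD; rewrite -(cut_same cD x1y) ?x1D // eq_sym.
    by apply: (cuts_subset Gconn cD cX _ _ wD wX1 xX x1D yD yX1); rewrite ?edgeE.
  have YD : Y \subset D.
    have [ewv|ewv] := eqVneq e [set w; v].
      case: (cut_uniq Gconn cD (F := Y)) => [|->//|ED]; first by rewrite ewv.
      by rewrite ED inE yY in yD.
    have vD : v \in D by rewrite -(cut_same cD (v := v) wv) // eq_sym.
    by apply: (cuts_subset Gconn cY' cD _ _ vY vD wD wY yY yD); rewrite ?edgeE.
  have DX2 : [disjoint D & X2] by apply: disjointWl DX1 disj12.
  have E : switch_cut y w X2 Y D = (D :\: Y) :|: X2.
    rewrite /switch_cut (negbTE yD) wD; apply/setP => z; rewrite !inE.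
    have := subsetP YD z; have := disjointFr DX2 (x := z).
    by case: (z \in D); case: (z \in Y); case: (z \in X2) => //= A1 A2;
       do [have := A1 isT | have := A2 isT].
  have EI : (D :\: Y) :&: X2 = set0.
    by apply/eqP; rewrite setI_eq0; apply: disjointWl DX2; apply: subsetDl.
  rewrite E cardsU EI cards0 cardsD (setIidPr YD).
  have := subset_leq_card DX1; have := subset_leq_card YD.
  exact: (switch_arith sizes le12 le23 Y0 Yw).
(* [cut e] is only one of the two sides of [e]; [D] is the side containing [w]. *)
have cutE e : e \in edges G -> (y \in cut e) = (w \in cut e) \/
    exists2 D, is_cut D e & [/\ w \in D, y \notin D & D = cut e \/ D = ~: cut e].
  move=> eE; have [->|p] := eqVneq (y \in cut e) (w \in cut e); first by left.
  have wE : (w \in cut e) = (y \notin cut e) by move: p; do 2![case: (_ \in _)].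
  right; have [yD|yD] := boolP (y \in cut e).
    by exists (~: cut e); rewrite ?is_cutC ?Gcut // !inE wE yD; split; auto.
  by exists (cut e); rewrite ?Gcut // wE yD; split; auto.
have key k e : 0 < k -> e \in edges G ->
    nsplits k (cut e) <= nsplits k (switch_cut y w X2 Y (cut e) : {set G}).
  move=> k0 eE; case: (cutE e eE) => [E|[D cD [wD yD ED]]].
    by rewrite /switch_cut E eqxx.
  have [lt1 lt2] := gain D e eE cD wD yD; have := nsplits_le k0 (ltnW lt1) (ltnW lt2).
  by case: ED => ->; rewrite // switch_cutC !nsplitsC.
have key2 e : e \in edges G -> (y \in cut e) != (w \in cut e) ->
    nsplits 2 (cut e) < nsplits 2 (switch_cut y w X2 Y (cut e) : {set G}).
  move=> eE; case: (cutE e eE) => [->|[D cD [wD yD ED]] _]; first by rewrite eqxx.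
  have [lt1 lt2] := gain D e eE cD wD yD; have := nsplits_lt lt1 lt2.
  by case: ED => ->; rewrite // switch_cutC !nsplitsC.
have SWE k : 0 < k ->
    SW G' k = \sum_(e in edges G) nsplits k (switch_cut y w X2 Y (cut e) : {set G}).
  exact: (SW_switch Gconn Gcut x2y wv yw cA aA wX2 cY' vY yY).
exists G'; split.
- exact: (switch_tree Gconn Gcut x2y wv yw cA aA wX2 cY' vY yY).
- exact: (switch_segment_sequence _ _ (switch_switched x2y wv yw cA aA wX2 cY' vY yY) yB wB).
- move=> k k0; rewrite SWE // (SW_cuts Gconn Gcut k0).
  by apply: leq_sum => e; apply: key.
have e0 : [set x1; y] \in edges G by rewrite edgeE.
rewrite SWE // (SW_cuts Gconn Gcut) // (bigD1 [set x1; y]) //=.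
rewrite [X in _ < X](bigD1 [set x1; y]) //=.
rewrite -addSn leq_add //; last by apply: leq_sum => e /andP[eE _]; apply: key.
apply: key2 => //.
case: (cut_uniq Gconn (Gcut e0) cX) => ->; rewrite ?inE (negbTE yX1) wX1 //.
Qed.

End Tripod.

(** * Subtrees of maximum degree two *)

Lemma ex_longest (T : finType) (P : pred (seq T)) :
    (exists s, P s) -> (forall s, P s -> uniq s) ->
  exists2 s, P s & forall t, P t -> size t <= size s.
Proof.
move=> [s0 Ps0] PU; pose Q n := [exists t : n.-tuple T, P t].
have QP s : P s -> Q (size s) by move=> Ps; apply/existsP; exists (in_tuple s).
have exQ : exists n, Q n by exists (size s0); apply: QP.
have bdQ n : Q n -> n <= #|T|.
  by case/existsP=> t /PU ut; rewrite -(size_tuple t) -(card_uniqP ut) max_card.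
case: (ex_maxnP exQ bdQ) => n /existsP[s Ps] maxn; exists (tval s) => // t /QP.
by rewrite size_tuple; apply: maxn.
Qed.

Definition branches (G : sgraph) : {set G} := [set x | branch x].

(** Three edges at [y] whose cuts split the set of branch vertices: each of the
    three parts beyond [y] contains a branch vertex, so the smallest does. *)
Lemma branching_core_improves (G : sgraph) (y x1 x2 x3 : G) :
    is_tree G -> uniq [:: x1; x2; x3] ->
    {in [:: x1; x2; x3], forall x, [set y; x] \in split_edges (@cut G) (branches G)} ->
  exists G' : sgraph, [/\ is_tree G', segment_sequence G' = segment_sequence G,
    forall k, 0 < k -> SW G k <= SW G' k & SW G 2 < SW G' 2].
Proof.
case: G y x1 x2 x3 => V r rs ri y x1 x2 x3; set G := SGraph rs ri => Gtree U core.
have [Gconn Gcut] := is_tree_cuts Gtree.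
have side x : x \in [:: x1; x2; x3] ->
    exists X w, [/\ adj x y, oriented_cut (X : {set G}) x y, w \in X & branch w].
  move=> /core; rewrite inE edgeE => /andP[yx /splitsP[s [t]]]; rewrite !inE.
  rewrite adj_sym in yx; have [X [cX xX yX]] := oriented_cutP Gcut yx.
  case=> sB tB sD tD; rewrite setUC in sD tD.
  have e0 : [set x; y] \in edges G by rewrite edgeE.
  have [E|E] := cut_uniq Gconn (Gcut _ e0) cX; rewrite E ?inE ?negbK in sD tD.
    by exists X, s.
  by exists X, t.
have [X1 [w1 [a1 o1 i1 b1]]] := side x1 (mem_head _ _).
have [|X2 [w2 [a2 o2 i2 b2]]] := side x2; first by rewrite !inE eqxx orbT.
have [|X3 [w3 [a3 o3 i3 b3]]] := side x3; first by rewrite !inE eqxx !orbT.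
have [n12 n13 n23] : [/\ x1 != x2, x1 != x3 & x2 != x3].
  by move: U; rewrite /= !inE negb_or andbT => /andP[/andP[-> ->] ->].
have [n21 n31 n32] : [/\ x2 != x1, x3 != x1 & x3 != x2].
  by rewrite (eq_sym x2 x1) !(eq_sym x3).
have improve := tripod_improves Gtree.
have [l12|/ltnW l12] := leqP #|X1| #|X2|; have [l23|/ltnW l23] := leqP #|X2| #|X3|;
  have [l13|/ltnW l13] := leqP #|X1| #|X3|.
- exact: (improve y x1 x2 x3 w1 X1 X2 X3).
- exact: (improve y x1 x2 x3 w1 X1 X2 X3).
- exact: (improve y x1 x3 x2 w1 X1 X3 X2).
- exact: (improve y x3 x1 x2 w3 X3 X1 X2).
- exact: (improve y x2 x1 x3 w2 X2 X1 X3).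
- exact: (improve y x2 x3 x1 w2 X2 X3 X1).
- exact: (improve y x3 x2 x1 w3 X3 X2 X1).
- exact: (improve y x3 x2 x1 w3 X3 X2 X1).
Qed.

Section Paths.
Variable G : sgraph.
Hypothesis Gtree : is_tree G.
Let Gcut := (is_tree_cuts Gtree).2.
Implicit Types (x y u v : G) (p q s : seq G) (H : subgraph G).

(** A tree has no chords: otherwise the rest of the path would connect the two
    sides of the cut of [xv]. *)
Lemma path_chord x q v :
    path (@adj G) x q -> uniq (x :: q) -> v \in q -> adj x v ->
  [set x; v] \in pedges (x :: q).
Proof.
case: q => [|h q] // /andP[xh hq] /andP[xU _] vq xv; rewrite pedges_cons inE.
have [->|vh] := eqVneq v h; first by rewrite eqxx.
have e0 : [set x; v] \in edges G by rewrite edgeE.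
have cD := Gcut e0; have := cut_const cD (set21 x v) hq xU vq.
rewrite (cut_ends cD xv) -(cut_same cD xh) ?eq_set2; first by case: (x \in _).
by rewrite negb_or !negb_and (eq_sym h) vh orbT /= (adj_neq xv).
Qed.

(** A longest path of [H] contains every edge of [H] at each of its vertices: an
    end has no further neighbour off the path by maximality, nor on it since
    there are no chords, and an inner vertex already has two neighbours. By
    connectedness the path is all of [H]. *)
Lemma connected_max_degree2_path H :
    is_subgraph H -> is_connected H ->
    (forall y x1 x2 x3, [set y; x1] \in H.2 -> [set y; x2] \in H.2 ->
       [set y; x3] \in H.2 -> ~~ uniq [:: x1; x2; x3]) ->
  is_path H.
Proof.
case: H => W E /andP[/= /subsetP EG /forall_inP EW] /andP[/set0Pn[x0 x0W] /= Hconn] deg2.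
set r := elink E; have rsym : symmetric r := @elink_sym _ E.
have rG : subrel r (@adj G) by move=> u v /EG; rewrite edgeE.
pose P q := [&& q != [::], uniq q, sorted r q & all (mem W) q].
have [p Pp longest] : exists2 p, P p & forall q, P q -> size q <= size p.
  apply: ex_longest; last by move=> q /and4P[].
  by exists [:: x0]; apply/and4P; rewrite /= andbT.
have first_closed q u v :
    P (u :: q) -> size p <= (size q).+1 -> r u v -> [set u; v] \in pedges (u :: q).
  move=> /and4P[_ uq rq qW] sq uv; apply: path_chord => //.
  - exact: (sub_path rG rq).
  - apply: contraLR sq => vq; rewrite -ltnNge; apply: (longest [:: v, u & q]).
    apply/and4P; split=> //.
    + by rewrite cons_uniq inE negb_or eq_sym (adj_neq (rG _ _ uv)) vq uq.
    + by rewrite -[sorted _ _]/(r v u && sorted r (u :: q)) rsym uv rq.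
    + rewrite -[all _ _]/((v \in W) && all (mem W) (u :: q)) qW.
      by rewrite (subsetP (EW _ uv)) ?set22.
  exact: rG.
have closed_p u v : u \in p -> r u v -> [set u; v] \in pedges p.
  have Prev : P (rev p).
    case/and4P: Pp => p0 up rp pW; apply/and4P; split.
    - by rewrite -size_eq0 size_rev size_eq0.
    - by rewrite rev_uniq.
    - by rewrite rev_sorted (eq_sorted (e' := r)).
    - by rewrite all_rev.
  move=> up uv; have [p1 [p2 Ep]] : exists p1 p2, p = p1 ++ u :: p2.
    by case/path.splitPr: up => p1 p2; exists p1, p2.
  case: (lastP p1) Ep => [|q1 a] Ep.
    by rewrite /= in Ep; rewrite Ep; apply: first_closed; rewrite // ?Ep // -Ep.
  case: p2 Ep => [|b q2] Ep.
    have Er : rev p = u :: rev (rcons q1 a) by rewrite Ep rev_cat.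
    rewrite -mem_rev -pedges_rev Er; apply: first_closed; rewrite // -?Er //.
    by rewrite size_rev Ep size_cat addn1.
  have [_ up' rp _] := and4P Pp.
  have Ep' : p = q1 ++ [:: a, u, b & q2] by rewrite Ep cat_rcons.
  have auE : [set u; a] \in pedges p.
    by rewrite Ep' pedges_cat mem_cat pedges_cons setUC mem_head orbT.
  have ubE : [set u; b] \in pedges p.
    by rewrite Ep pedges_cat mem_cat pedges_cons mem_head orbT.
  have adjE w : [set u; w] \in pedges p -> [set u; w] \in E := pedges_adj rsym rp.
  have ab : a != b.
    move: up'; rewrite Ep' cat_uniq => /and3P[_ _ /andP[+ _]].
    by apply: contraNneq => ->; rewrite !inE eqxx orbT.
  have := deg2 u a b v (adjE _ auE) (adjE _ ubE) uv.
  by rewrite /= !inE !negb_or ab andbT /= negb_and !negbK => /orP[]/eqP<-.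
have /and4P[p0 up rp /allP pW] := Pp.
have EpP u v : [set u; v] \in pedges p -> r u v := @pedges_adj _ r p u v rsym rp.
have Wp v : v \in W -> v \in p.
  case: p p0 pW closed_p {EpP rp up Pp first_closed longest} => // z p _ pW closed_p vW.
  have clP : closed r (mem (z :: p)).
    apply: intro_closed; first exact: sym_connect_sym.
    by move=> a b ab /closed_p/(_ ab)/pedges_sub; apply; rewrite set22.
  have /forall_inP/(_ z (pW _ (mem_head _ _)))/forall_inP/(_ v vW) zv := Hconn.
  by have := closed_connect clP zv; rewrite /= mem_head => <-.
exists p; split=> //; first by apply: sub_sorted rp.
congr pair; apply/setP => e; rewrite inE.
  by apply/idP/idP => [/Wp|/pW].
apply/idP/idP => [eE|].
  have /edgesP[u [v [uv Ee]]] := EG _ eE; rewrite Ee.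
  apply: closed_p; last by rewrite /r /elink -Ee.
  by apply/Wp/(subsetP (EW _ eE)); rewrite Ee set21.
case/pedgesP => p1 [u [v [p2 [Ep ->]]]]; apply: EpP.
by rewrite Ep pedges_cat mem_cat mem_head orbT.
Qed.

End Paths.

(** * Segments through an edge *)

Section Segments.
Variable G : sgraph.
Hypothesis Gtree : is_tree G.
Let Gcut := (is_tree_cuts Gtree).2.
Implicit Types (x y u v z : G) (p q s : seq G) (H : subgraph G) (e : {set G}).

Lemma deg2_neighbours x u v z :
  deg x = 2 -> adj x u -> adj x v -> u != v -> adj x z -> z \in [:: u; v].
Proof.
move=> x2 xu xv uv xz; have : [set u; v] \subset [set z | adj x z].
  by apply/subsetP => t; rewrite !inE => /orP[]/eqP->.
move/subset_leqif_cards/geq_leqif; rewrite cards2 uv -[#|[set z | adj x z]|]/(deg x) x2 /=.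
by move/esym/eqP/setP/(_ z); rewrite !inE xz.
Qed.

Lemma chain_free_end x s y :
    chain x s y -> ~~ (leaf x || branch x) ->
  deg x = 2 /\ exists2 t, adj t x & t \notin x :: rcons s y.
Proof.
case/and3P=> us ps _; rewrite /leaf /branch negb_or -leqNgt => /andP[x1 x3].
have [h [q Eh]] : exists h q, rcons s y = h :: q.
  by case: s {us ps} => [|h s]; [exists y, [::] | exists h, (rcons s y)].
rewrite Eh in us ps *; have xh : adj x h by case/andP: ps.
have hN : h \in [set z | adj x z] by rewrite inE.
have x2 : deg x = 2.
  have := cardsD1 h [set z | adj x z]; rewrite hN -/(deg x).
  by move: x1 x3; rewrite /deg; case: #|_| => [|[|[|]]].
split=> //; have /card_gt0P[t] : 0 < #|[set z | adj x z] :\ h|.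
  have := cardsD1 h [set z | adj x z].
  by rewrite hN -[#|[set z | adj x z]|]/(deg x) x2; case: #|_ :\ _|.
rewrite !inE => /andP[th xt]; exists t; first by rewrite adj_sym.
rewrite negb_or eq_sym (adj_neq xt) /=; apply/negP => tq.
have := path_chord Gtree ps us tq xt; rewrite pedges_cons inE.
case/orP=> [|/pedges_sub/(_ (set21 _ _))].
  by rewrite eq_set2 (negbTE th) andbF => /andP[/eqP E _]; rewrite E adj_irr in xh.
by case/andP: us => /negbTE->.
Qed.

Lemma chain_cons x s y t :
  chain x s y -> deg x = 2 -> adj t x -> t \notin x :: rcons s y -> chain t (x :: s) y.
Proof.
case/and3P=> us ps s2 x2 tx tq; apply/and3P; split.
- by rewrite rcons_cons cons_uniq tq.
- by rewrite /= tx.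
by rewrite /= x2.
Qed.

(** A chain is extended at an end of degree 2 until both ends are leaves or
    branch vertices; [n] bounds the number of extensions. *)
Lemma chain_in_segment n x s y e :
    #|G| <= size s + n -> chain x s y -> e \in pedges (x :: rcons s y) ->
  exists x' s' y', segment_path x' s' y' /\ e \in pedges (x' :: rcons s' y').
Proof.
elim: n x s y => [|n IH] x s y le_n cs es.
  have /and3P[us _ _] := cs; have := max_card (mem (x :: rcons s y)).
  by rewrite (card_uniqP us) /= size_rcons => /ltnW; rewrite ltnNge -(addn0 (size s)) le_n.
have [xE|xE] := boolP (leaf x || branch x); last first.
  have [x2 [t tx tq]] := chain_free_end cs xE.
  apply: (IH t (x :: s) y); rewrite ?chain_cons //; first by rewrite addSnnS.
  by rewrite rcons_cons pedges_cons inE es orbT.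
have [yE|yE] := boolP (leaf y || branch y); last first.
  rewrite -chain_rev in cs; rewrite -pedges_swap_ends in es.
  have [y2 [t ty tq]] := chain_free_end cs yE.
  apply: (IH t (y :: rev s) x); rewrite ?chain_cons //; first by rewrite /= size_rev addSnnS.
  by rewrite rcons_cons pedges_cons inE es orbT.
by exists x, s, y; rewrite segment_pathE cs xE yE.
Qed.

Lemma edge_in_segment e : e \in edges G ->
  exists x s y, segment_path x s y /\ e \in pedges (x :: rcons s y).
Proof.
case/edgesP=> u [v [uv ->]].
apply: (chain_in_segment (n := #|G|) (x := u) (s := [::]) (y := v) (leqnn _)).
  by apply/and3P; rewrite /= inE (adj_neq uv) uv.
by rewrite mem_head.
Qed.

(** The induction along a path that starts at a leaf: [P] is the set of vertices
    already passed, which can be left only by the first edge of the rest of the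
    path, and therefore is a cut of that edge. *)
Lemma cut_near_end x q e (P : {set G}) :
    path (@adj G) x q -> uniq (x :: q) -> {in q, forall z, z \notin P} ->
    x \in P -> {in P, forall z, deg z <= 2} ->
    (forall a b, a \in P -> adj a b -> b \notin P -> a = x /\ b = head x q) ->
    {in q, forall z, z != last x q -> deg z = 2} ->
    e \in pedges (x :: q) ->
  exists2 D, is_cut D e & D :&: branches G = set0.
Proof.
elim: q x P => [|v q IH] x P // /andP[xv vq] /andP[xU vU] qP xP P2 clP q2.
rewrite pedges_cons inE => /orP[/eqP->|eq].
  exists P; last first.
    apply/setP => z; rewrite !inE /branch; case zP: (z \in P) => //=.
    by rewrite ltnNge P2.
  apply/is_cutP => s t st; apply/esym.
  have cross a b : adj a b -> a \in P -> b \notin P -> [set a; b] == [set x; v].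
    by move=> ab aP bP; have [-> ->] := clP a b aP ab bP.
  case sP: (s \in P); case tP: (t \in P) => /=.
  - apply/negbTE; rewrite eq_set2; apply/negP => /orP[]/andP[/eqP Es /eqP Et];
      by have := qP v (mem_head _ _); rewrite -?Es -?Et ?sP ?tP.
  - by rewrite cross ?tP.
  - by rewrite setUC cross ?sP // adj_sym.
  - rewrite eq_set2; apply/negbTE/negP => /orP[]/andP[/eqP Es /eqP Et];
      by move: xP; rewrite -?Es -?Et ?sP ?tP.
case: q vq xU vU qP clP q2 eq IH => [|w q] // vq xU vU qP clP q2 eq IH.
have vwl : v != last v (w :: q).
  by have /andP[vwq _] := vU; apply: contraNneq vwq => E; rewrite {1}E /= mem_last.
have v2 : deg v = 2 by apply: q2; rewrite ?mem_head.
have xw : x != w by apply: contraNneq xU => ->; rewrite !inE eqxx orbT.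
have vw : adj v w by case/andP: vq.
apply: (IH v (v |: P)) => //.
- move=> z zq; rewrite in_setU1 negb_or; apply/andP; split.
    by apply: contraNneq (andP vU).1 => <-.
  by apply: qP; rewrite in_cons zq orbT.
- by rewrite setU11.
- by move=> z; rewrite !inE => /orP[/eqP->|/P2//]; rewrite v2.
- move=> s t + st; rewrite !inE negb_or => /orP[/eqP Es|sP] /andP[tv tP].
    rewrite {}Es in st *; split=> //; rewrite adj_sym in xv.
    have := deg2_neighbours v2 xv vw xw st; rewrite !inE => /orP[/eqP Et|/eqP//].
    by rewrite Et xP in tP.
  by have [_ /= Et] := clP s t sP st tP; rewrite Et eqxx in tv.
by move=> z zq zl; apply: q2; rewrite // inE zq orbT.
Qed.

End Segments.

(** * Removing the pendant segments *)

Section Pendant.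
Variable G : sgraph.
Hypothesis Gtree : is_tree G.
Let Gconn : connected_graph G := (is_tree_cuts Gtree).1.
Let Gcut := (is_tree_cuts Gtree).2.
Implicit Types (x y u v z : G) (p q s : seq G) (H : subgraph G) (e : {set G}).

Lemma leaf_neighbour x u v : leaf x -> adj x u -> adj x v -> u = v.
Proof.
move=> /cards1P[w E] xu xv; have := set11 w.
by have : u \in [set w] by [rewrite -E inE]; have : v \in [set w] by [rewrite -E inE];
   rewrite !inE => /eqP-> /eqP->.
Qed.

Lemma mem_path_subgraph p x : (x \in (path_subgraph p).1) = (x \in p).
Proof. by rewrite inE. Qed.

Lemma mem_path_subgraph2 p e : (e \in (path_subgraph p).2) = (e \in pedges p).
Proof. by rewrite inE. Qed.

Lemma leaf_end x s y t :
  segment_path x s y -> t \in x :: rcons s y -> leaf t -> t = x \/ t = y.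
Proof.
case/and4P=> _ _ /allP s2 _; rewrite inE mem_rcons inE => /or3P[/eqP|/eqP|/s2/eqP t2]; auto.
by rewrite /leaf t2.
Qed.

Lemma pedges_edges x q e : path (@adj G) x q -> e \in pedges (x :: q) -> e \in edges G.
Proof.
move=> xq eq; have /pedgesP[p1 [u [v [p2 [_ Ee]]]]] := eq; rewrite Ee in eq *.
by rewrite edgeE; apply: (pedges_adj (p := x :: q)) eq => //; exact: adj_sym.
Qed.

(** The part of the tree beyond an edge of a pendant segment, towards the leaf,
    is a part of that segment and contains no branch vertex. *)
Lemma pendant_edge_not_split H e :
  H \in pendant_segments G -> e \in H.2 -> ~~ splits (cut e) (branches G).
Proof.
rewrite inE => /andP[/segmentsP[x [s [y [seg ->]]]] /exists_inP[t]].
rewrite mem_path_subgraph mem_path_subgraph2 => tq tl eq.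
wlog Et : x s y seg tq eq / t = x => [wl|].
  have [|Et] := leaf_end seg tq tl; first exact: (wl x s y).
  apply: (wl y (rev s) x) => //; rewrite ?segment_path_rev ?pedges_swap_ends //.
  by rewrite Et mem_head.
subst t; have /and4P[us ps /allP s2 _] := seg.
have sN z : z \in rcons s y -> z \notin [set x].
  by move=> zs; rewrite inE; apply: contraTneq us => <-; rewrite /= zs.
have [|||D cD DB] := cut_near_end (P := [set x]) ps us sN (set11 x) _ _ _ eq.
- by move=> z /set1P->; rewrite (eqP tl).
- move=> a b /set1P-> xb _; split=> //; apply: (leaf_neighbour tl xb).
  by case: s ps {us s2 sN seg tq eq} => [|h s] /andP[].
- move=> z; rewrite mem_rcons inE last_rcons => /orP[->|/s2/eqP] //.
have eE := pedges_edges ps eq; have DB' z : z \in D -> z \in branches G = false.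
  by move=> zD; move/setP/(_ z): DB; rewrite inE zD in_set0.
apply/splitsP => -[b1 [b2 [b1B b2B b1D b2D]]].
have [E|E] := cut_uniq Gconn (Gcut eE) cD; rewrite E ?inE ?negbK in b1D b2D.
  by rewrite DB' in b1B.
by rewrite DB' in b2B.
Qed.

(** The two ends of the segment through [e] are on different sides of the cut of
    [e]; the one on the side without branch vertices is a leaf. *)
Lemma unsplit_edge_pendant e :
  e \in edges G -> ~~ splits (cut e) (branches G) ->
  exists2 H, H \in pendant_segments G & e \in H.2.
Proof.
move=> eE; have [x [s [y [seg eq]]]] := edge_in_segment Gtree eE.
have /and4P[us ps _ /andP[xE yE]] := seg.
have := path_edge_separates ps us eq (Gcut eE); rewrite last_rcons => yx nsplit.
have pend t : t \in x :: rcons s y -> leaf t ->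
    exists2 H, H \in pendant_segments G & e \in H.2.
  move=> tq tl; exists (path_subgraph (x :: rcons s y)); rewrite ?mem_path_subgraph2 //.
  rewrite inE; apply/andP; split; first by apply/segmentsP; exists x, s, y.
  by apply/exists_inP; exists t; rewrite ?mem_path_subgraph.
have [xB|xB] := boolP (branch x); last first.
  by apply: (pend x); rewrite ?mem_head //; move: xE; rewrite (negbTE xB) orbF.
have [yB|yB] := boolP (branch y); last first.
  apply: (pend y); first by rewrite inE mem_rcons mem_head orbT.
  by move: yE; rewrite (negbTE yB) orbF.
case/splitsP: nsplit; have [xD|xD] := boolP (x \in cut e); rewrite xD in yx.
  by exists x, y; rewrite !inE xB yB xD yx.
by exists y, x; rewrite !inE xB yB xD yx.
Qed.

Lemma segment_all_edges x s y v u :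
    segment_path x s y -> v \in x :: rcons s y -> ~~ branch v -> adj v u ->
  [set v; u] \in pedges (x :: rcons s y).
Proof.
move=> seg vq vB vu.
have first_edge x' s' y' : segment_path x' s' y' -> ~~ branch x' -> adj x' u ->
    [set x'; u] \in pedges (x' :: rcons s' y').
  rewrite segment_pathE => /and3P[/and3P[_ ps _] xE _] xB xu.
  rewrite (negbTE xB) orbF in xE.
  case: s' ps => [|h s'] /andP[xh _]; rewrite (leaf_neighbour xE xu xh);
  by rewrite ?rcons_cons pedges_cons mem_head.
move: vq; rewrite inE mem_rcons inE => /or3P[/eqP Ev|/eqP Ev|vs].
- by rewrite Ev in vu vB *; apply: first_edge.
- rewrite Ev in vu vB *; rewrite -pedges_swap_ends; apply: first_edge => //.
  by rewrite segment_path_rev.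
have /and4P[us ps /allP/(_ v vs)/eqP v2 _] := seg.
have [p1 [a [b [p2 Eq]]]] : exists p1 a b p2, x :: rcons s y = p1 ++ [:: a, v, b & p2].
  case/path.splitPr: vs => s1 s2; rewrite rcons_cat -cat_cons lastI cat_rcons.
  exists (belast x s1), (last x s1).
  by case: s2 => [|b s2]; [exists y, [::] | exists b, (rcons s2 y)].
rewrite Eq in us *; have avE : [set v; a] \in pedges (p1 ++ [:: a, v, b & p2]).
  by rewrite pedges_cat mem_cat pedges_cons setUC mem_head orbT.
have vbE : [set v; b] \in pedges (p1 ++ [:: a, v, b & p2]).
  by rewrite pedges_cat mem_cat !pedges_cons !inE eqxx !orbT.
have adjE w : [set v; w] \in pedges (p1 ++ [:: a, v, b & p2]) -> adj v w.
  by rewrite -Eq; exact: (pedges_adj (p := x :: rcons s y) (@adj_sym G) ps).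
have ab : a != b.
  move: us; rewrite cat_uniq => /and3P[_ _ /andP[+ _]].
  by apply: contraNneq => ->; rewrite !inE eqxx orbT.
have := deg2_neighbours v2 (adjE _ avE) (adjE _ vbE) ab vu.
by rewrite !inE => /orP[]/eqP->.
Qed.

(** The edges agree by [pendant_edge_not_split] and [unsplit_edge_pendant]. As for the
    vertices, all edges at a vertex of a segment that is not a branch vertex
    belong to the segment, so such a vertex is removed exactly when its edges
    are. *)
Lemma remove_pendantE :
  branches G != set0 -> remove_pendant G = steiner_tree (@cut G) (branches G).
Proof.
case/set0Pn=> b0 b0B; congr pair; apply/setP.
  move=> x; rewrite !inE; have [//|xB] := boolP (branch x).
  have [u xu] : exists u, adj x u.
    have /connectP[[|u p] /=] := Gconn x b0; last by case/andP=> xu _ _; exists u.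
    by move=> _ Ex; rewrite inE Ex (negbTE xB) in b0B.
  have uE : [set x; u] \in edges G by rewrite edgeE.
  apply/forall_inP/bigcupP => [noP|[e]].
    exists [set x; u]; rewrite ?set21 // inE uE /=.
    apply: contraT => /(unsplit_edge_pendant uE)[H Hp uH].
    have := Hp; rewrite inE => /andP[/segmentsP[y [s [z [_ EH]]]] _].
    have := noP H Hp; rewrite EH mem_path_subgraph (pedges_sub (e := [set x; u])) //.
      by rewrite -mem_path_subgraph2 -EH.
    exact: set21.
  rewrite inE => /andP[/edgesP[a [b [ab ->]]] spl] xe H Hp.
  have [t xt Ee] : exists2 t, adj x t & [set a; b] = [set x; t].
    move: xe; rewrite !inE => /orP[]/eqP->; [by exists b | exists a; last by rewrite setUC].
    by rewrite adj_sym.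
  apply: contraL spl => xH; apply: (pendant_edge_not_split Hp); rewrite Ee.
  have := Hp; rewrite inE => /andP[/segmentsP[y [s [z [seg EH]]]] _].
  rewrite EH mem_path_subgraph2; rewrite EH mem_path_subgraph in xH.
  exact: (segment_all_edges seg).
move=> e; rewrite !inE; have [eE|] := boolP (e \in edges G); rewrite ?andbF // andbT.
apply/idP/idP.
  by apply: contraR => /(unsplit_edge_pendant eE)[H Hp eH]; apply/bigcupP; exists H.
by apply: contraL => /bigcupP[H Hp eH]; apply: pendant_edge_not_split Hp eH.
Qed.

End Pendant.

(** * Maximal trees are quasi-caterpillars *)

Lemma quasi_caterpillarI (G : sgraph) :
    is_tree G ->
    (forall y x1 x2 x3 : G, uniq [:: x1; x2; x3] ->
       ~ {in [:: x1; x2; x3], forall x, [set y; x] \in split_edges (@cut G) (branches G)}) ->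
  quasi_caterpillar G.
Proof.
move=> Gtree nocore; split=> //; have [Gconn Gcut] := is_tree_cuts Gtree.
have [B0|B0] := eqVneq (branches G) set0; [left | right]; last first.
  rewrite remove_pendantE //; apply: connected_max_degree2_path => //.
  - exact: steiner_tree_subgraph.
  - exact: steiner_tree_connected.
  move=> y x1 x2 x3 e1 e2 e3; apply/negP => U; apply: (nocore y _ _ _ U) => x.
  by rewrite !inE => /or3P[] /eqP->; rewrite -?in_set ?inE; move: e1 e2 e3; rewrite !inE.
apply: connected_max_degree2_path => //; last 2 first.
- by case: Gtree.
- move=> y x1 x2 x3; rewrite /= !edgeE => e1 e2 e3; apply/negP => U.
  have : y \in branches G; last by rewrite B0 inE.
  rewrite inE /branch /deg (leq_trans _ (subset_leq_card (A := [set x1; x2; x3]) _)) //.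
    move: U; rewrite /= !inE negb_or andbT => /andP[/andP[n12 n13] n23].
    by rewrite -setUA cardsU1 cards2 !inE negb_or n12 n13 n23.
  by apply/subsetP => x; rewrite !inE => /orP[/orP[]|]/eqP->.
by apply/andP; split=> //=; apply/forall_inP => e _; apply: subsetT.
Qed.

Lemma leq_card_bigcup (I T : finType) (P : pred I) (F : I -> {set T}) :
  #|\bigcup_(i | P i) F i| <= \sum_(i | P i) #|F i|.
Proof.
elim/big_rec2: _ => [|i n A _ IH]; first by rewrite cards0.
by rewrite (leq_trans (leq_card_setU _ _)) // leq_add2l.
Qed.

Lemma card_edges_le (G : sgraph) :
  is_tree G -> #|edges G| <= sumn (segment_sequence G).
Proof.
move=> Gtree; rewrite (perm_sumn (permEl (perm_sort _ _))) sumnE big_map big_enum /=.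
apply: leq_trans (leq_card_bigcup _ _); apply/subset_leq_card/subsetP => e eE.
have [x [s [y [seg eq]]]] := edge_in_segment Gtree eE.
apply/bigcupP; exists (path_subgraph (x :: rcons s y)); last by rewrite inE.
by apply/segmentsP; exists x, s, y.
Qed.

Lemma card_vertices_le (G : sgraph) : is_tree G -> #|G| <= (#|edges G|.*2).+1.
Proof.
move=> Gtree; have [Gconn _] := is_tree_cuts Gtree.
have [/andP[/set0Pn[x0 _] _] _] := Gtree.
have sub : [set: G] \subset x0 |: \bigcup_(e in edges G) e.
  apply/subsetP => x _; rewrite in_setU1; have [//|xx0] := eqVneq x x0.
  have /connectP[[|u p] /=] := Gconn x x0; first by move=> _ E; rewrite E eqxx in xx0.
  case/andP=> xu _ _; apply/bigcupP; exists [set x; u]; rewrite ?set21 ?edgeE //.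
rewrite -cardsT (leq_trans (subset_leq_card sub)) // (leq_trans (leq_card_setU _ _)) //.
rewrite cards1 ltnS (leq_trans (leq_card_bigcup _ _)) // -muln2 -sum_nat_const leq_sum // => e.
by case/edgesP => u [v [_ ->]]; rewrite cards2; case: (_ != _).
Qed.

Lemma SW_bound (G : sgraph) k l :
  tree_with_segments G l -> SW G k <= 2 ^ (sumn l).*2.+1 * sumn l.
Proof.
case=> Gtree <-; set m := sumn _; have edge_le : #|edges G| <= m := card_edges_le Gtree.
apply: (@leq_trans (#|{set G}| * m)).
  rewrite -sum_nat_const /SW [X in X <= _]big_mkcond leq_sum // => S _.
  by case: ifP => // _; apply: leq_trans (steiner_dist_le S) edge_le.
rewrite leq_mul2r -[#|{set G}|]cardsT -powersetT card_powerset cardsT leq_exp2l //.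
by rewrite (leq_trans (card_vertices_le Gtree)) ?orbT // ltnS leq_double.
Qed.

Lemma bounded_argmax (X : Type) (P : X -> Prop) (f : X -> nat) N :
    (exists x, P x) -> (forall x, P x -> f x <= N) ->
  exists x, P x /\ forall y, P y -> f y <= f x.
Proof.
move=> [x Px] fN; have [m] := ubnP (N - f x).
elim: m x Px => // m IH x Px ltm.
have [[y [Py lt_fxy]]|nomore] := classic (exists y, P y /\ f x < f y).
  by apply: (IH y Py); move: ltm lt_fxy (fN y Py); lia.
exists x; split=> // y Py; rewrite leqNgt; apply/negP => lt_fxy.
by apply: nomore; exists y.
Qed.

Theorem theorem1p2 (k : nat) (l : seq nat) (hk : 0 < k)
    (hl : exists T : sgraph, tree_with_segments T l) :
  exists Tstar : sgraph,
    [/\ tree_with_segments Tstar l,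
        quasi_caterpillar Tstar
      & forall T : sgraph, tree_with_segments T l -> SW T k <= SW Tstar k].
Proof.
pose M := 2 ^ (sumn l).*2.+1 * sumn l.
(* [M] bounds [SW T 2], so [f] orders trees lexicographically. *)
pose f T := SW T k * M.+1 + SW T 2.
have fM T : tree_with_segments T l -> f T <= M * M.+1 + M.
  by move=> Tl; rewrite leq_add ?leq_mul ?SW_bound.
have [T [Tl Tmax]] := bounded_argmax hl fM; have [Ttree Tseq] := Tl.
exists T; split=> //.
  apply: quasi_caterpillarI => // y x1 x2 x3 U core.
  have [T' [T'tree T'seq leSW ltSW]] := branching_core_improves Ttree U core.
  have /Tmax : tree_with_segments T' l by split; rewrite ?T'seq.
  rewrite leqNgt /f => /negP[]; rewrite -addnS leq_add //.
  by rewrite leq_mul2r leSW.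
move=> T1 T1l; rewrite leqNgt; apply/negP => ltSW.
have := Tmax T1 T1l; rewrite leqNgt => /negP[]; rewrite /f.
apply: (@leq_trans ((SW T k).+1 * M.+1)).
  by rewrite mulSnr -addnS leq_add2l ltnS SW_bound.
by rewrite (leq_trans _ (leq_addr _ _)) // leq_mul2r ltSW orbT.
Qed.
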